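(* Let $m\ge 1$ be an integer, let $M>0$, let $f\in C^1(\mathbb{R})$, and put $G(u)=\int_u^M f$. Assume that $f$ is odd in $\mathbb{R}$; that $G\ge 0=G(\pm M)$ in $\mathbb{R}$ and $G>0$ in $(-M,M)$; and that $f'$ is decreasing in $(0,M)$. Then every bounded solution $u$ of $-\Delta u=f(u)$ in $\mathbb{R}^{2m}$ that vanishes on the Simons cone $\mathcal{C}=\{s=t\}$ and has the same sign as $s-t$ is stable in $\mathbb{R}^{2m}$ with respect to perturbations vanishing on $\mathcal{C}$; that is, $$Q_u(\xi)=\int_{\mathbb{R}^{2m}}\left\{|\nabla\xi|^2-f'(u)\xi^2\right\}dx\ge 0$$ for all $\xi\in C^1(\mathbb{R}^{2m})$ with compact support and such that $\xi\equiv 0$ on $\mathcal{C}$.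
   Context: For $x=(x^1,x^2)\in\mathbb{R}^m\times\mathbb{R}^m=\mathbb{R}^{2m}$ set $s=|x^1|$ and $t=|x^2|$ (Euclidean norms in $\mathbb{R}^m$). The Simons cone is $\mathcal{C}=\{s=t\}$. ''Having the same sign as $s-t$'' means $u>0$ where $s>t$ and $u<0$ where $s<t$. Solutions are classical ($C^2$) solutions. *)

(* Defs.v *)
From HB Require Import structures.
From mathcomp Require Import all_boot all_order all_algebra.
From mathcomp Require Import all_classical all_reals all_analysis.

Set Implicit Arguments.
Unset Strict Implicit.
Unset Printing Implicit Defensive.

Import Order.TTheory GRing.Theory Num.Theory.
Import numFieldNormedType.Exports.

Local Open Scope ring_scope.
Local Open Scope classical_set_scope.

(* Lebesgue measure on R^n, built as the n-fold product of [lebesgue_measure];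
   the carrier is [n.-tuple], which the library equips with the product
   sigma-algebra.  [lebesgue_tuple_box] gives the volume of boxes. *)
Section lebesgue_tuple.
Context (R : realType).
Local Notation TR := (measurableTypeR R).

Definition tuple_cons n (p : TR * n.-tuple TR) : n.+1.-tuple TR :=
  [tuple of p.1 :: p.2].

Lemma measurable_tuple_cons n : measurable_fun setT (@tuple_cons n).
Proof. exact: measurable_cons measurable_fst measurable_snd. Qed.

Section step.
Context n (mu : {sigma_finite_measure set (n.-tuple TR) -> \bar R}).

Definition tuple_cons_measure : set (n.+1.-tuple TR) -> \bar R :=
  pushforward (@lebesgue_measure R \x mu)%E (@tuple_cons n).

Let pm : {measure set (n.+1.-tuple TR) -> \bar R} :=
  measure_function_pushforward__canonical__measure_function_Measure
    (@lebesgue_measure R \x mu)%E (@measurable_tuple_cons n).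

HB.instance Definition _ := isMeasure.Build _ _ _ tuple_cons_measure
  (measure0 pm) (measure_ge0 pm) (@measure_semi_sigma_additive _ _ _ pm).

Let sigma_finite_tuple_cons : sigma_finite setT tuple_cons_measure.
Proof.
have /sigma_finiteP[F [TF ndF Foo]] := sigma_finiteT (@lebesgue_measure R).
have /sigma_finiteP[G [TG ndG Goo]] := sigma_finiteT mu.
pose g (t : n.+1.-tuple TR) := [tuple of behead t] : n.-tuple TR.
have gE a t : g (tuple_cons (a, t)) = t by exact: val_inj.
have preE i : tuple_cons_measure
    ((fun t => tnth t ord0) @^-1` F i `&` g @^-1` G i) =
    (@lebesgue_measure R (F i) * mu (G i))%E.
  have [mF _] := Foo i; have [mG _] := Goo i.
  rewrite -product_measure1E//; congr (product_measure1 _ _ _).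
  apply/seteqP; split=> -[a t] /=;
    by rewrite gE /tuple_cons /= (_ : tnth _ ord0 = a).
exists (fun i => (fun t => tnth t ord0) @^-1` F i `&` g @^-1` G i).
  apply/esym/seteqP; split=> // t _.
  have [i _ Fi] : (\bigcup_i F i) (tnth t ord0) by rewrite -TF.
  have [j _ Gj] : (\bigcup_i G i) (g t) by rewrite -TG.
  exists (maxn i j) => //; split => /=.
    by move: Fi; exact/subsetPset/ndF/leq_maxl.
  by move: Gj; exact/subsetPset/ndG/leq_maxr.
move=> i; have [mF Fi] := Foo i; have [mG Gi] := Goo i; split.
  apply: measurableI.
    by rewrite -[X in measurable X]setTI; exact: measurable_tnth.
  by rewrite -[X in measurable X]setTI; exact: measurable_behead.
by rewrite preE lte_mul_pinfty// ge0_fin_numE.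
Qed.

HB.instance Definition _ := Measure_isSigmaFinite.Build _ _ _
  tuple_cons_measure sigma_finite_tuple_cons.

End step.

Fixpoint lebesgue_tuple n : {sigma_finite_measure set (n.-tuple TR) -> \bar R} :=
  match n with
  | 0%N => \d_([tuple] : 0.-tuple TR)
  | k.+1 => tuple_cons_measure (lebesgue_tuple k)
  end.

Lemma lebesgue_tuple_box n (A : 'I_n -> set TR) :
  (forall i, measurable (A i)) ->
  lebesgue_tuple n [set t | forall i, A i (tnth t i)] =
  (\prod_(i < n) lebesgue_measure (A i))%E.
Proof.
elim: n A => [|n IH] A mA.
  by rewrite big_ord0 /= diracE mem_set// => -[].
rewrite big_ord_recl -IH// -product_measure1E//.
  congr (product_measure1 _ _ _); apply/seteqP; split=> -[a t] /=.
    move=> At; split; first exact: (At ord0).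
    move=> i; have := At (lift ord0 i).
    by rewrite tnthS; congr (A _ (tnth _ _)); exact: val_inj.
  move=> [Aa At] i; have [j ->|->//] := unliftP ord0 i.
  by rewrite tnthS; have := At j; congr (A _ (tnth _ _)); exact: val_inj.
rewrite (_ : [set t | _] = \big[setI/setT]_(i < n)
    ((fun t : n.-tuple TR => tnth t i) @^-1` A (lift ord0 i))).
  apply: bigsetI_measurable => i _.
  by rewrite -[X in measurable X]setTI; exact: measurable_tnth.
apply/seteqP; split=> t /= At.
  by elim/big_rec: _ => // i B _ tB; split => //; exact: At.
by move=> i; move: At; rewrite (bigD1 i)//= => -[].
Qed.

End lebesgue_tuple.

Section euclidean_calculus.
Context (R : realType) (n : nat).
Implicit Types (g : 'rV[R]_n -> R) (x : 'rV[R]_n).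

(* The library norm on ['rV_n] is the sup norm. *)
Definition enorm x : R := Num.sqrt (\sum_(i < n) x 0 i ^+ 2).

Definition partial (i : 'I_n) g : 'rV[R]_n -> R := 'D_(delta_mx 0 i) g.

Definition gradient g x : 'rV[R]_n := \row_i partial i g x.

Definition laplacian g x : R := \sum_(i < n) partial i (partial i g) x.

Fixpoint continuously_differentiable (k : nat) g : Prop :=
  match k with
  | 0%N => continuous g
  | j.+1 => (forall x, differentiable g x) /\
            forall i, continuously_differentiable j (partial i g)
  end.

Definition compactly_supported g : Prop := compact (closure [set x | g x != 0]).

Definition euclidean_integral g : \bar R :=
  (\int[lebesgue_tuple R n]_t (g (\row_i (tnth t i : R)))%:E)%E.

End euclidean_calculus.

(* The integral of [f] from [a] to [b], with the usual sign when [b < a]. *)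
Definition oriented_integral (R : realType) (f : R -> R) (a b : R) : R :=
  if a <= b then \int[lebesgue_measure]_(v in `[a, b]) f v
  else - \int[lebesgue_measure]_(v in `[b, a]) f v.

Definition potential (R : realType) (f : R -> R) (M v : R) : R :=
  oriented_integral f v M.

Definition C1_real (R : realType) (f : R -> R) : Prop :=
  (forall v, derivable f v 1) /\ continuous (derive1 f).

Section simons_cone.
Context (R : realType) (m : nat).
Implicit Types (x : 'rV[R]_(m + m)) (u xi : 'rV[R]_(m + m) -> R).

Definition cone_s x : R := enorm (lsubmx x).
Definition cone_t x : R := enorm (rsubmx x).

Definition simons_cone : set 'rV[R]_(m + m) := [set x | cone_s x = cone_t x].

Definition same_sign_s_minus_t u : Prop :=
  (forall x, cone_t x < cone_s x -> 0 < u x) /\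
  (forall x, cone_s x < cone_t x -> u x < 0).

Definition classical_solution (f : R -> R) u : Prop :=
  continuously_differentiable 2 u /\ forall x, - laplacian u x = f (u x).

(* Extended-real valued, so that non-negativity cannot hold by a default value
   of the real-valued integral. *)
Definition quadratic_form (f : R -> R) u xi : \bar R :=
  euclidean_integral (fun x =>
    enorm (gradient xi x) ^+ 2 - derive1 f (u x) * xi x ^+ 2).

Definition stable_vanishing_on_cone (f : R -> R) u : Prop :=
  forall xi, continuously_differentiable 1 xi -> compactly_supported xi ->
    (forall x, simons_cone x -> xi x = 0) ->
    (0 <= quadratic_form f u xi)%E.

End simons_cone.

(* Main.v *)
(** First, [|u| < M]. On [{s >= t}] compare [u] with a profile of the signed
    distance [(s - t) / sqrt 2] to the cone, which is superharmonic there: if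
    [w'' = -f(w) - k exp(-w)] is the increasing profile with [w(0) = 0] and
    positive energy, then [w((s - t) / sqrt 2)] is a strict supersolution.
    With [H = w^-1], maximize [H(u) - (s - t) / sqrt 2 - e |x|^2] for small
    [e]: a positive maximum contradicts the equation, so [H(u) <= (s - t) /
    sqrt 2]. As [k -> 0], the distance [H(M)] needed to reach [M] tends to
    infinity, because [G] vanishes quadratically at [M]; hence [u < M]. The
    other side of the cone is treated by applying this to [-u].

    Second, concavity and oddness of [f] give [f(u) / u >= f'(u)] where [u <>
    0], so [u] solves [Delta u / u <= - f'(u)] off the cone. For [chi(xi) =
    (|xi| - e)_+ ^ 2], the field [chi(xi) grad u / u] is [C^1] with compact
    support, since [xi] vanishes where [u] does. Its divergence is at most
    [|grad xi|^2 - f'(u) chi(xi)] and has integral zero; then let [e -> 0]. *)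

Require Import Defs.
From HB Require Import structures.
From mathcomp Require Import all_boot all_order all_algebra.
From mathcomp Require Import all_classical all_reals all_analysis.
From mathcomp Require Import measurable_realfun ring lra.

Import Order.TTheory GRing.Theory Num.Theory.
Import numFieldNormedType.Exports.

Local Open Scope ring_scope.
Local Open Scope classical_set_scope.

Set Implicit Arguments.
Unset Strict Implicit.
Unset Printing Implicit Defensive.

(** * Calculus in one variable *)

Section one_variable.
Context {R : realType}.
Implicit Types (F g : R -> R) (a b c d e x : R).

Lemma is_derive_mul (V : normedModType R) (p q : V -> R) (x v : V) dp dq :
  is_derive x v p dp -> is_derive x v q dq ->
  is_derive x v (fun y => p y * q y) (p x * dq + q x * dp).
Proof. by move=> hp hq; exact: is_deriveM. Qed.

Lemma is_derive_scale (V : normedModType R) (p : V -> R) (k : R) (x v : V) dp :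
  is_derive x v p dp -> is_derive x v (fun y => k * p y) (k * dp).
Proof. by move=> hp; exact: is_deriveZ. Qed.

Lemma is_derive_add (V : normedModType R) (p q : V -> R) (x v : V) dp dq :
  is_derive x v p dp -> is_derive x v q dq ->
  is_derive x v (fun y => p y + q y) (dp + dq).
Proof. by move=> hp hq; exact: is_deriveD. Qed.

Lemma is_derive_sub (V : normedModType R) (p q : V -> R) (x v : V) dp dq :
  is_derive x v p dp -> is_derive x v q dq ->
  is_derive x v (fun y => p y - q y) (dp - dq).
Proof. by move=> hp hq; exact: is_deriveB. Qed.

Lemma is_derive_continuous F x d : is_derive x 1 F d -> {for x, continuous F}.
Proof.
by move=> [Fx _]; apply: differentiable_continuous; exact/derivable1_diffP.
Qed.

Lemma mean_value F g a b : a < b ->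
  (forall x, a <= x <= b -> is_derive x 1 F (g x)) ->
  exists2 c, a < c < b & F b - F a = g c * (b - a).
Proof.
move=> ab Fg; have [||c] := @MVT R F g a b ab.
- by move=> x; rewrite in_itv/= => /andP[/ltW ? /ltW ?]; apply: Fg; apply/andP.
- apply: continuous_in_subspaceT => x; rewrite inE/= in_itv/= => xab.
  exact: is_derive_continuous (Fg _ xab).
- by rewrite in_itv/=; exists c.
Qed.

Lemma derive_nondecreasing F g a b : a <= b ->
  (forall x, a <= x <= b -> is_derive x 1 F (g x)) ->
  (forall x, a < x < b -> 0 <= g x) -> F a <= F b.
Proof.
rewrite le_eqVlt => /predU1P[->//|ab] Fg g0.
have [c cab e] := mean_value ab Fg.
by rewrite -subr_ge0 e mulr_ge0 ?g0// subr_ge0 ltW.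
Qed.

Lemma antiderivative_exists g : continuous g ->
  exists2 F, F 0 = 0 & forall x, is_derive x 1 F (g x).
Proof.
move=> cg.
have ig a b : lebesgue_measure.-integrable `[a, b] (EFin \o g).
  apply: continuous_compact_integrable; first exact: segment_compact.
  exact: continuous_subspaceT.
have loc c : forall x, c < x ->
    is_derive x 1 (fun y => \int[lebesgue_measure]_(t in `[c, y]) g t) (g x).
  move=> x cx; have xx1 : x < x + 1 by rewrite ltrDl.
  have [|d1 d2] := @continuous_FTC1_closed R g c x (x + 1) xx1 (ig _ _) cx.
    exact: cg.
  by split; [exact: d1|rewrite -derive1E; exact: d2].
(* The fundamental theorem needs a left endpoint, here [- n]. Subtracting the integral up to [0]
   makes the candidates for different [n] agree, so that they glue to one function on the whole
   line. *)
pose Fn (n : nat) := fun y => \int[lebesgue_measure]_(t in `[- n%:R, y]) g t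
   - \int[lebesgue_measure]_(t in `[- n%:R, 0]) g t.
have dFn n x : - n%:R < x -> is_derive x 1 (Fn n) (g x).
  move=> nx; rewrite -[g x]subr0; apply: is_derive_sub; exact: loc.
have eqF n k y : (n <= k)%N -> - n%:R < y -> Fn k y = Fn n y.
  move=> nk ny.
  have kn : - k%:R <= - n%:R :> R by rewrite lerN2 ler_nat.
  have split0 z : - n%:R <= z ->
      \int[lebesgue_measure]_(t in `[- k%:R, z]) g t =
      \int[lebesgue_measure]_(t in `[- k%:R, - n%:R]) g t +
      \int[lebesgue_measure]_(t in `[- n%:R, z]) g t.
    move=> nz; apply/eqP; rewrite addrC -subr_eq; apply/eqP.
    rewrite (@Rintegral_itvB R g (BLeft (- k%:R)) (BRight z) (- n%:R))//.
    rewrite Rintegral_itv_obnd_cbnd//.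
    by apply: integrableS (ig (- n%:R) z) => //; apply: subset_itv; rewrite bnd_simp.
  rewrite /Fn (split0 y (ltW ny)) (split0 0) ?oppr_le0 ?ler0n//.
  by rewrite opprD addrACA subrr add0r.
pose N (y : R) := Num.bound `|y|.
have Ny y : - (N y)%:R < y.
  by rewrite ltrNl (le_lt_trans _ (archi_boundP (normr_ge0 y)))// -normrN ler_norm.
exists (fun y => Fn (N y) y); first by rewrite /Fn subrr.
move=> x; apply: (@near_eq_is_derive _ _ _ (Fn (N x))) => //; last exact: dFn.
near=> y.
have ny : - (N x)%:R < y by near: y; exact: lt_nbhsr (Ny x).
by have [h|/ltnW h] := leqP (N x) (N y); [symmetry|]; apply: eqF.
Unshelve. all: by end_near. Qed.

Lemma oriented_integralE F g : (forall x, is_derive x 1 F (g x)) -> continuous g ->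
  forall a b, oriented_integral g a b = F b - F a.
Proof.
move=> Fg cg a b.
have lt_case c d : c < d ->
    \int[lebesgue_measure]_(v in `[c, d]) g v = F d - F c.
  move=> cd; rewrite /Rintegral (@continuous_FTC2 R g F c d)//.
  - exact: continuous_subspaceT.
  - have cF x : {for x, continuous F} by apply: is_derive_continuous (Fg x).
    split; [by move=> x _; case: (Fg x)|exact: cvg_at_right_filter (cF c)|].
    exact: cvg_at_left_filter (cF d).
  - by move=> x _; rewrite derive1E; case: (Fg x).
rewrite /oriented_integral; case: ltgtP => [ab|ba|->].
- exact: lt_case.
- by rewrite lt_case// opprB.
- by rewrite set_itv1 Rintegral_set1 subrr.
Qed.

Lemma derive_local_max F d x e : 0 < e ->
  (forall y, `|y - x| < e -> derivable F y 1) ->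
  is_derive x 1 F d -> (forall y, `|y - x| < e -> F y <= F x) -> d = 0.
Proof.
move=> e0 dF [_ <-] Fmax.
have nearx y : (y \in `]x - e, x + e[%R) = (`|y - x| < e).
  by rewrite in_itv/= ltr_norml; apply/andP/andP => -[? ?]; split; lra.
have : is_derive x 1 F 0; last by case.
apply: (@derive1_at_max R F (x - e) (x + e)); first lra.
- by move=> t; rewrite nearx => /dF.
- by rewrite nearx subrr normr0.
- by move=> t; rewrite nearx; exact: Fmax.
Qed.

(** If [d] were positive, [g] would be positive just to the right of its zero [x], and the mean
    value theorem would lift [F] above [F x]. *)
Lemma second_derive_local_max F g d x e : 0 < e ->
  (forall y, `|y - x| < e -> is_derive y 1 F (g y)) ->
  is_derive x 1 g d -> (forall y, `|y - x| < e -> F y <= F x) ->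
  g x = 0 /\ d <= 0.
Proof.
move=> e0 Fg gd Fmax.
have gx0 : g x = 0.
  have Fx : is_derive x 1 F (g x) by apply: Fg; rewrite subrr normr0.
  by apply: derive_local_max e0 _ Fx Fmax => y /Fg[].
split=> //; rewrite leNgt; apply/negP => d0.
have [r r0 gpos] : exists2 r, 0 < r & forall y, x < y < x + r -> 0 < g y.
  have [gx gE] := gd; rewrite -gE in d0.
  have := cvgr_gt _ gx _ d0; rewrite near_withinE => /(_ _)/nbhs_ballP[r /= r0 hr].
  exists r => // y /andP[xy yx].
  have := hr (y - x); rewrite /= /ball/= sub0r normrN gtr0_norm ?subr_gt0//.
  rewrite ltrBlDl => /(_ yx); rewrite gt_eqF ?subr_gt0// => /(_ isT).
  rewrite /shift/= /GRing.scale/= mulr1 subrK gx0 subr0 pmulr_rgt0//.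
  by rewrite invr_gt0 subr_gt0.
pose y := x + Num.min r e / 2.
have m0 : 0 < Num.min r e by rewrite lt_min r0.
have mr : Num.min r e <= r by rewrite ge_min lexx.
have me : Num.min r e <= e by rewrite ge_min lexx orbT.
have xy : x < y by rewrite /y; lra.
have near_e z : x <= z <= y -> `|z - x| < e.
  by move=> /andP[xz zy]; rewrite ger0_norm ?subr_ge0// ltrBlDl; rewrite /y in zy; lra.
have [z zxy|c /andP[xc cy] e1] := @mean_value F g x y xy; first exact/Fg/near_e.
have : 0 < F y - F x.
  by rewrite e1 mulr_gt0 ?subr_gt0// gpos// xc/=; rewrite /y in cy; lra.
by rewrite ltNge subr_le0 Fmax// near_e// lexx ltW.
Qed.

(** Adding a linear term of slope [c] or [- c] keeps the maximum at [x], so [d + c] and [d - c]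
    would both vanish. This excludes maxima at the kink of the distance to the cone. *)
Lemma local_max_no_kink F d c x e : 0 < e -> 0 < c ->
  (forall y, `|y - x| < e -> derivable F y 1) -> is_derive x 1 F d ->
  ~ forall y, `|y - x| < e -> F y + c * `|y - x| <= F x.
Proof.
move=> e0 c0 dF Fd Fmax.
have tilt (k : R) : `|k| = c -> d + k = 0.
  have line (y : R) : is_derive y 1 (fun y => k * (y - x)) k.
    have := is_derive_scale k (is_derive_sub (is_derive_id y 1) (is_derive_cst x y 1)).
    by rewrite subr0 mulr1.
  move=> kc; apply: (derive_local_max e0 _ (is_derive_add Fd (line x))).
  - by move=> y /dF dFy; apply: derivableD => //; case: (line y).
  - move=> y yx; rewrite subrr mulr0 addr0; apply: le_trans (Fmax y yx).
    by rewrite lerD2l (le_trans (ler_norm _))// normrM kc.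
have := tilt c; rewrite gtr0_norm// => /(_ erefl).
have := tilt (- c); rewrite normrN gtr0_norm// => /(_ erefl).
lra.
Qed.

End one_variable.

(** * Strict supersolutions in one variable *)

Section profile.
Context {R : realType}.
Implicit Types v z : R.
Variables (f G : R -> R) (M : R).
Hypothesis G'f : forall v, is_derive v 1 G (- f v).
Hypothesis G_ge0 : forall v, 0 <= G v.

Lemma is_derive_expRN (v : R) : is_derive v 1 (fun y => expR (- y)) (- expR (- v)).
Proof.
have := @is_derive1_comp R expR -%R v _ _ (is_derive_expR (- v)) (is_deriveNid v 1).
by rewrite mulrN1.
Qed.

(* The inverse [w] of [H] solves [w'^2 = 2 (G(w) + k exp(-w))], hence
   [-w'' = f(w) + k exp(-w)]: a strict supersolution of [-w'' = f(w)]. *)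
Lemma supersolution_profile (k : R) : 0 < k ->
  exists H h : R -> R, [/\ H 0 = 0, forall v, is_derive v 1 H (h v),
    forall v, 0 < h v,
    forall v, is_derive v 1 h (h v ^+ 3 * (f v + k * expR (- v))) &
    forall v, h v = (Num.sqrt (2 * (G v + k * expR (- v))))^-1].
Proof.
move=> k0; pose P v := 2 * (G v + k * expR (- v)).
have P0 v : 0 < P v by rewrite mulr_gt0// ltr_wpDl// mulr_gt0// expR_gt0.
have P' v : is_derive v 1 P (- (2 * (f v + k * expR (- v)))).
  have := is_derive_scale 2 (is_derive_add (G'f v) (is_derive_scale k (is_derive_expRN v))).
  by rewrite mulrN -opprD mulrN.
pose h v := (Num.sqrt (P v))^-1.
have h0 v : 0 < h v by rewrite invr_gt0 sqrtr_gt0.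
have h' v : is_derive v 1 h (h v ^+ 3 * (f v + k * expR (- v))).
  have s0 : (Num.sqrt \o P) v != 0 by rewrite gt_eqF// sqrtr_gt0.
  have sq := @is_derive1_comp R Num.sqrt P v _ _ (is_derive1_sqrt (P0 v)) (P' v).
  have := is_deriveV s0 sq.
  suff -> : - Num.sqrt (P v) ^- 2 *: ((2 * Num.sqrt (P v))^-1 * - (2 * (f v + k * expR (- v))))
    = h v ^+ 3 * (f v + k * expR (- v)) by [].
  by rewrite /h /GRing.scale/=; field.
have ch : continuous h by move=> v; apply: is_derive_continuous (h' v).
have [H H0 H'] := antiderivative_exists ch.
by exists H, h.
Qed.

(* [G] vanishes quadratically at [M], so [H M] blows up logarithmically as
   [k -> 0]. *)
Lemma supersolution_profile_slow (L : R) : 0 < M -> C1_real f -> G M = 0 ->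
  exists (H h : R -> R) (k : R), [/\ 0 < k, L < H M &
    [/\ H 0 = 0, forall v, is_derive v 1 H (h v), forall v, 0 < h v &
    forall v, is_derive v 1 h (h v ^+ 3 * (f v + k * expR (- v)))]].
Proof.
move=> M0 [df cf'] GM.
(* [M] minimizes [G], whose derivative is [- f]. *)
have fM : f M = 0.
  have NG v : is_derive v 1 (fun v => - G v) (f v).
    by rewrite -[f v]opprK; exact: is_deriveN.
  apply: (derive_local_max ltr01 _ (NG M)).
  - by move=> y _; case: (NG y).
  - by move=> y _; rewrite lerN2 GM.
have f' v : is_derive v 1 f (derive1 f v) by split=> //; rewrite derive1E.
have [C C0 fC] : exists2 C, 0 <= C & forall z, 0 <= z <= M -> f z <= C * (M - z).
  have c0M : {within `[0, M], continuous (fun v => - derive1 f v)}.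
    by apply: continuous_subspaceT => v; apply: continuousN; exact: cf'.
  have [c c0 cmax] := EVT_max (ltW M0) c0M.
  exists (Num.max 0 (- derive1 f c)); first by rewrite le_max lexx.
  move=> z /andP[z0]; rewrite le_eqVlt => /predU1P[->|zM].
    by rewrite fM subrr mulr0.
  have [b /andP[zb bM]] := mean_value zM (fun v _ => f' v).
  rewrite fM sub0r => /eqP; rewrite eqr_oppLR -mulNr => /eqP ->.
  rewrite ler_wpM2r ?subr_ge0 ?(ltW zM)// le_max; apply/orP; right.
  by apply: cmax; rewrite in_itv/= (le_trans z0 (ltW zb)) ltW.
have GC z : 0 <= z <= M -> G z <= C / 2 * (M - z) ^+ 2.
  move=> /andP[z0 zM].
  have sq v : is_derive v 1 (fun y => (M - y) * (M - y)) (- (2 * (M - v))).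
    have l1 : is_derive v 1 (fun y => M - y) (0 - 1).
      exact: is_derive_sub (is_derive_cst M v 1) (is_derive_id v 1).
    have := is_derive_mul l1 l1.
    by rewrite (_ : _ + _ = - (2 * (M - v)))//; ring.
  have nd := @derive_nondecreasing R (fun v => G v - C / 2 * ((M - v) * (M - v))) _
    z M zM (fun v _ => is_derive_sub (G'f v) (is_derive_scale (C / 2) (sq v))).
  have : G z - C / 2 * ((M - z) * (M - z)) <= G M - C / 2 * ((M - M) * (M - M)).
    apply: nd => v /andP[zv vM]; have := fC v; rewrite (le_trans z0 (ltW zv)) ltW//.
    by move=> /(_ isT); lra.
  by rewrite GM subrr !mulr0 subr0 subr_le0 expr2.
pose D := C + 1.
have D0 : 0 < D by rewrite /D; lra.
(* With [k = r ^+ 2], the root in the denominator of [h z] is at most [2 * (D * (M - z) + r)].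
   Integrating over [[0, M]] bounds [H M] below by [(2 * D)^-1 * ln (D * M / r)], and this [r] makes
   the bound equal to [L + 1]. *)
pose r := D * M * expR (- (2 * D * (L + 1))).
have r0 : 0 < r by rewrite !mulr_gt0// expR_gt0.
have k0 : 0 < r ^+ 2 by rewrite exprn_gt0.
have [H [h [H0 H' h0 h' hE]]] := supersolution_profile k0.
exists H, h, (r ^+ 2); split => //.
pose W z := D * (M - z) + r.
have W0 z : z <= M -> 0 < W z.
  by move=> zM; rewrite /W ltr_wpDl// mulr_ge0 ?(ltW D0)// subr_ge0.
have hW z : 0 <= z <= M -> (2 * W z)^-1 <= h z.
  move=> zM; have /andP[z0 zM'] := zM; have Wz := W0 z zM'.
  have ez : expR (- z) <= 1 by rewrite -expR0 ler_expR oppr_le0.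
  have e0 := expR_gt0 (- z).
  rewrite hE lef_pV2 ?posrE ?sqrtr_gt0 ?mulr_gt0//; last first.
    by rewrite ltr_wpDl// mulr_gt0.
  rewrite -[leRHS]ger0_norm ?mulr_ge0 ?(ltW Wz)// -sqrtr_sqr ler_wsqrtr//.
  have Mz : 0 <= M - z by rewrite subr_ge0.
  have hG := GC z zM.
  have q0 : 0 <= (M - z) ^+ 2 by rewrite exprn_ge0.
  have hG2 : C / 2 * (M - z) ^+ 2 <= D ^+ 2 * (M - z) ^+ 2.
    by rewrite ler_wpM2r// /D; nra.
  have hr : r ^+ 2 * expR (- z) <= r ^+ 2 by rewrite ger_pMr.
  have hc : 0 <= D * (M - z) * r by rewrite !mulr_ge0// ltW.
  have hd : 0 <= D ^+ 2 * (M - z) ^+ 2 by rewrite mulr_ge0// exprn_ge0// ltW.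
  rewrite /W; nra.
have lnW z : z <= M -> is_derive z 1 (fun y => ln (W y)) ((W z)^-1 * - D).
  move=> zM.
  have W' : is_derive z 1 W (- D).
    have := is_derive_add (is_derive_scale D (is_derive_sub (is_derive_cst M z 1)
      (is_derive_id z 1))) (is_derive_cst r z 1).
    by rewrite (_ : _ + _ = - D)//; ring.
  exact: (@is_derive1_comp R (@ln R) W z _ _ (is_derive1_ln (W0 z zM)) W').
have : H 0 + (2 * D)^-1 * ln (W 0) <= H M + (2 * D)^-1 * ln (W M).
  apply: (@derive_nondecreasing R (fun z => H z + (2 * D)^-1 * ln (W z))
    (fun z => h z + (2 * D)^-1 * ((W z)^-1 * - D))); first exact: ltW.
  - move=> z /andP[_ zM]; apply: is_derive_add => //.
    exact/is_derive_scale/lnW.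
  - move=> z /andP[z0 zM]; have hz : (2 * W z)^-1 <= h z.
      by apply: hW; apply/andP; split; exact: ltW.
    move: hz; rewrite -subr_ge0 (_ : _ - _ = h z + (2 * D)^-1 * ((W z)^-1 * - D))//.
    by field; rewrite !gt_eqF// W0// ltW.
rewrite H0 add0r -lerBlDr -mulrBr => hHM.
apply: lt_le_trans hHM.
have -> : W M = r by rewrite /W subrr mulr0 add0r.
have : ln (D * M) <= ln (W 0).
  have DMW : D * M <= W 0 by rewrite /W subr0 lerDl ltW.
  have DM0 : 0 < D * M by rewrite mulr_gt0.
  by rewrite ler_ln ?posrE// (lt_le_trans DM0).
have -> : ln r = ln (D * M) - 2 * D * (L + 1).
  by rewrite /r [LHS]lnM ?posrE ?expR_gt0 ?mulr_gt0// expRK.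
move=> hln; rewrite mulrC ltr_pdivlMr ?mulr_gt0//; nra.
Qed.

End profile.

(** * Comparison with the distance to the cone *)

Section lines.
Context {R : realType} {n : nat}.
Implicit Types (g u : 'rV[R]_n -> R) (x : 'rV[R]_n) (i : 'I_n) (A : {set 'I_n}).

Definition line x i (t : R) : 'rV[R]_n := x + t *: delta_mx 0 i.

Lemma line0 x i : line x i 0 = x.
Proof. by rewrite /line scale0r addr0. Qed.

Lemma lineE x i t j : line x i t 0 j = x 0 j + (if j == i then t else 0).
Proof.
by rewrite !mxE eqxx eq_sym/=; case: eqP => _ /=; rewrite ?mulr1 ?mulr0.
Qed.

Lemma is_derive_line g x i (t : R) : differentiable g (line x i t) ->
  is_derive t 1 (fun t => g (line x i t)) (partial i g (line x i t)).
Proof.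
move=> dg; have dgi := @diff_derivable _ _ _ g (line x i t) (delta_mx 0 i) dg.
have e : (fun h : R => h^-1 *: (((fun t => g (line x i t)) \o shift t) (h *: 1) -
      g (line x i t))) =
    (fun h : R => h^-1 *: ((g \o shift (line x i t)) (h *: delta_mx 0 i) -
      g (line x i t))).
  apply/funext => h /=; congr (_ *: (g _ - _)).
  have -> : h *: (1 : R) = h by exact: mulr1.
  by rewrite /line addrCA scalerDl.
by split; rewrite /partial /derivable /derive e.
Qed.

Lemma continuous_line x i : continuous (line x i).
Proof.
move=> t; apply: cvgD; first exact: cvg_cst.
exact: scalel_continuous.
Qed.

(** For a suitable [A], the radii of [A] and of its complement are [cone_s] and [cone_t]. Keeping
    [A] variable treats both sides of the cone by one argument. *)
Definition radius A x : R := Num.sqrt (\sum_(i in A) x 0 i ^+ 2).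

Lemma radius_ge0 A x : 0 <= radius A x.
Proof. exact: sqrtr_ge0. Qed.

Lemma sqr_radius A x : radius A x ^+ 2 = \sum_(i in A) x 0 i ^+ 2.
Proof. by rewrite sqr_sqrtr// sumr_ge0// => i _; rewrite sqr_ge0. Qed.

Lemma continuous_sum_sqr A : continuous (fun x => \sum_(i in A) x 0 i ^+ 2).
Proof.
apply: (continuous_big (@add_continuous R)) => i _ x.
exact: (continuousM (@coord_continuous _ _ _ _ _ _) (@coord_continuous _ _ _ _ _ _)).
Qed.

Lemma continuous_radius A : continuous (radius A).
Proof.
move=> x; apply: (@continuous_comp _ _ _ (fun x => \sum_(i in A) x 0 i ^+ 2) (@Num.sqrt R)).
  exact: continuous_sum_sqr.
exact: sqrt_continuous.
Qed.

Lemma sum_sqr_line A x i t : \sum_(j in A) line x i t 0 j ^+ 2 =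
  \sum_(j in A) x 0 j ^+ 2 + (if i \in A then 2 * x 0 i * t + t ^+ 2 else 0).
Proof.
case: ifPn => iA; last first.
  rewrite addr0; apply: eq_bigr => j jA; rewrite lineE ifN ?addr0//.
  by apply: contraNneq iA => <-.
rewrite (bigD1 i)//= [in RHS](bigD1 i)//= lineE eqxx.
rewrite (@eq_bigr _ _ _ _ _ _ _ (fun j => x 0 j ^+ 2)).
  by ring.
by move=> j /andP[_ ji]; rewrite lineE (negbTE ji) addr0.
Qed.

(** Along the coordinate line through [x] in a direction [i] of [A], [radius A] is this root, with
    [q] the square of the radius at [x] and [b = x 0 i]. *)
Lemma is_derive_sqrt_quadratic (q b t : R) : 0 < q + 2 * b * t + t ^+ 2 ->
  is_derive t 1 (fun t => Num.sqrt (q + 2 * b * t + t ^+ 2))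
    ((b + t) / Num.sqrt (q + 2 * b * t + t ^+ 2)).
Proof.
move=> pos; pose P t : R := q + 2 * b * t + t * t.
have PE s : q + 2 * b * s + s ^+ 2 = P s by rewrite expr2.
have P' : is_derive t 1 P (2 * (b + t)).
  apply: (is_derive_eq (is_derive_add (is_derive_add (is_derive_cst q t 1)
    (is_derive_scale (2 * b) (is_derive_id t 1)))
    (is_derive_mul (is_derive_id t 1) (is_derive_id t 1)))).
  by rewrite /=; ring.
rewrite (_ : (fun _ => _) = Num.sqrt \o P); last by apply/funext => s; rewrite PE.
rewrite PE in pos *.
apply: (is_derive_eq (@is_derive1_comp R Num.sqrt P t _ _ (is_derive1_sqrt pos) P')).
by field; rewrite gt_eqF// sqrtr_gt0.
Qed.

Lemma is_derive2_sqrt_quadratic (q b : R) : 0 < q ->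
  is_derive (0 : R) 1 (fun t => (b + t) / Num.sqrt (q + 2 * b * t + t ^+ 2))
    ((Num.sqrt q)^-1 - b ^+ 2 / Num.sqrt q ^+ 3).
Proof.
move=> q0; have s0 : 0 < Num.sqrt q by rewrite sqrtr_gt0.
have q0' : q + 2 * b * 0 + 0 ^+ 2 = q by ring.
pose S (t : R) := Num.sqrt (q + 2 * b * t + t ^+ 2).
have D : is_derive (0 : R) 1 S ((b + 0) / S 0).
  by apply: is_derive_sqrt_quadratic; rewrite q0'.
have S0 : S 0 = Num.sqrt q by rewrite /S q0'.
have nz : S 0 != 0 by rewrite S0 gt_eqF.
apply: (is_derive_eq (is_derive_mul (is_derive_add (is_derive_cst b (0 : R) 1)
  (is_derive_id (0 : R) 1)) (is_deriveV nz D))).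
by rewrite S0 /cst /GRing.scale/=; field; rewrite gt_eqF.
Qed.

End lines.

Lemma compact_in_box {R : realType} {n : nat} (A : set 'rV[R]_n) (L : R) :
  closed A -> (forall x, A x -> forall i, `|x 0 i| <= L) -> compact A.
Proof.
move=> clA AL.
apply: (subclosed_compact clA (@rV_compact _ _ (fun=> `[- L, L]) _)).
  by move=> _; exact: segment_compact.
by move=> x Ax i; rewrite /= in_itv/= -ler_norml; exact: AL.
Qed.

Section comparison.
Context {R : realType} {n : nat}.
Variables (A : {set 'I_n}) (u : 'rV[R]_n -> R) (H h dh : R -> R).
Hypothesis du : forall x, differentiable u x.
Hypothesis d2u : forall i x, differentiable (partial i u) x.
Hypothesis H' : forall v : R, is_derive v 1 H (h v).
Hypothesis h' : forall v : R, is_derive v 1 h (dh v).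
Implicit Types (x : 'rV[R]_n) (i : 'I_n) (c e t : R).

(* Penalized difference of [H u] and [c] times the difference of the radii; with
   [c = 1 / sqrt 2] the latter is the distance to the cone. *)
Let excess c e x :=
  H (u x) - c * (radius A x - radius (~: A) x) - e * \sum_i x 0 i ^+ 2.

Let is_derive_Hu x i t : is_derive t 1 (fun t => H (u (line x i t)))
  (h (u (line x i t)) * partial i u (line x i t)).
Proof.
exact: (@is_derive1_comp R H (fun t => u (line x i t)) t _ _ (H' _) (is_derive_line (du _))).
Qed.

Let sum_sqrT x : \sum_i x 0 i ^+ 2 = \sum_(i in finset.setTfor 'I_n) x 0 i ^+ 2.
Proof. by apply: eq_bigl => i; rewrite finset.in_setT. Qed.

Let line_sum x i t : \sum_j line x i t 0 j ^+ 2 =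
  \sum_j x 0 j ^+ 2 + (2 * x 0 i * t + t * t).
Proof. by rewrite !sum_sqrT sum_sqr_line finset.in_setT expr2. Qed.

(** These are the first and second derivative tests at [t = 0]. Here [r] and the sign of [c] are
    free: coordinates in [A] use [c] and the radius of [A], the others [- c] and the radius of the
    complement. *)
Lemma touching_coordinate c e x i r r0 : 0 < r -> 0 < r0 ->
  (forall t, `|t| < r0 -> H (u (line x i t))
     - c * Num.sqrt (r ^+ 2 + 2 * x 0 i * t + t ^+ 2) - e * (2 * x 0 i * t + t * t)
     <= H (u x) - c * r) ->
  h (u x) * partial i u x = (c / r + 2 * e) * x 0 i /\
  dh (u x) * partial i u x ^+ 2 + h (u x) * partial i (partial i u) x
    <= c * (r^-1 - x 0 i ^+ 2 / r ^+ 3) + 2 * e.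
Proof.
move=> rpos r00 Fmax; set b := x 0 i in Fmax *.
pose q : R := r ^+ 2; have q0 : 0 < q by rewrite exprn_gt0.
have sq : Num.sqrt q = r by rewrite sqrtr_sqr gtr0_norm.
pose S t := Num.sqrt (q + 2 * b * t + t ^+ 2).
pose F t := H (u (line x i t)) - c * S t - e * (2 * b * t + t * t).
pose g t := h (u (line x i t)) * partial i u (line x i t) - c * ((b + t) / S t)
  - e * (2 * b + (t + t)).
(* The second bound keeps the radicand [q + 2 * b * t + t ^+ 2] positive, hence the root
   differentiable. *)
pose d := Num.min r0 (q / (2 * `|b| + 1)).
have b0 : 0 < 2 * `|b| + 1 by rewrite ltr_wpDl// mulr_ge0.
have d0 : 0 < d by rewrite lt_min r00 divr_gt0.
have F' t : `|t - 0| < d -> is_derive t 1 F (g t).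
  rewrite subr0 lt_min => /andP[_]; rewrite ltr_pdivlMr// => tq.
  apply: is_derive_sub; first apply: is_derive_sub => //.
    apply: is_derive_scale; apply: is_derive_sqrt_quadratic.
    have bt : - (`|b| * `|t|) <= b * t by rewrite -normrM lerNnormlW.
    have := sqr_ge0 t; have := normr_ge0 t; nra.
  apply: is_derive_scale; apply: (is_derive_eq (is_derive_add
    (is_derive_scale (2 * b) (is_derive_id t 1))
    (is_derive_mul (is_derive_id t 1) (is_derive_id t 1)))).
  by rewrite /=; ring.
have dp : is_derive (0 : R) 1 (fun t => partial i u (line x i t))
    (partial i (partial i u) x).
  by have := @is_derive_line R n (partial i u) x i 0 (d2u _ _); rewrite line0.
have dhu : is_derive (0 : R) 1 (fun t => h (u (line x i t))) (dh (u x) * partial i u x).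
  have dul := @is_derive_line R n u x i 0 (du _).
  have := @is_derive1_comp R h (fun t => u (line x i t)) 0 _ _ (h' _) dul.
  by rewrite line0.
have g' : is_derive (0 : R) 1 g (h (u x) * partial i (partial i u) x
    + partial i u x * (dh (u x) * partial i u x)
    - c * (r^-1 - b ^+ 2 / r ^+ 3) - e * 2).
  apply: is_derive_sub; first apply: is_derive_sub.
  - by have := is_derive_mul dhu dp; rewrite line0.
  - by have := is_derive_scale c (is_derive2_sqrt_quadratic b q0); rewrite sq.
  - apply: is_derive_scale; apply: (is_derive_eq (is_derive_add
      (is_derive_cst (2 * b) (0 : R) 1)
      (is_derive_add (is_derive_id (0 : R) 1) (is_derive_id (0 : R) 1)))).
    by rewrite add0r.
have S0 : S 0 = r by rewrite /S mulr0 expr0n/= !addr0.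
have [|g0 g2] := second_derive_local_max d0 F' g'.
- move=> t; rewrite subr0 lt_min => /andP[tr _]; apply: le_trans (Fmax t tr) _.
  by rewrite /F line0 S0; lra.
- move: g0; rewrite /g line0 S0 !addr0 => g0.
  have -> : (c / r + 2 * e) * b = c * (b / r) + e * (2 * b) by ring.
  split; [lra|].
  by move: g2; rewrite mulrA [partial i u x * _]mulrC -mulrA -expr2; lra.
Qed.

Variables (f k : R -> R) (K c : R).
Hypothesis dhE : forall v : R, dh v = h v ^+ 3 * (f v + k v).
Hypotheses (H0 : H 0 = 0) (h_gt0 : forall v : R, 0 < h v).
Hypotheses (cf : continuous f) (ck : continuous k) (k_gt0 : forall v, 0 < k v).
Hypothesis u_le : forall x, u x <= K.
Hypothesis u_sol : forall x, - laplacian u x = f (u x).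
Hypothesis u_cone : forall x, radius A x = radius (~: A) x -> u x = 0.
Hypothesis cardA : #|A| = #|~: A|.
Hypothesis A_neq0 : (0 < #|~: A|)%N.
Hypotheses (c_gt0 : 0 < c) (cE : 2 * c ^+ 2 = 1).

Let sum_split (F : 'I_n -> R) :
  \sum_i F i = \sum_(i in A) F i + \sum_(i in ~: A) F i.
Proof.
rewrite (bigID (mem A))/=; congr (_ + _).
by apply: eq_bigl => i; rewrite finset.in_setC.
Qed.

Let H_homo : {homo H : v w / v <= w}.
Proof.
move=> v w vw; apply: (derive_nondecreasing vw (fun z _ => H' z)) => z _.
exact: ltW.
Qed.

Let sum_sqr_radius x :
  \sum_i x 0 i ^+ 2 = radius A x ^+ 2 + radius (~: A) x ^+ 2.
Proof. by rewrite sum_split !sqr_radius. Qed.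

Let radius_line (B : {set 'I_n}) x i t : radius B (line x i t) =
  if i \in B then Num.sqrt (radius B x ^+ 2 + 2 * x 0 i * t + t ^+ 2)
  else radius B x.
Proof.
rewrite {1}/radius sum_sqr_line sqr_radius.
by case: ifPn => _; rewrite ?addr0 ?addrA.
Qed.

Let excess_line e x i t : excess c e (line x i t) = H (u (line x i t))
  - (if i \in A then c else - c) * Num.sqrt
      ((if i \in A then radius A x else radius (~: A) x) ^+ 2
        + 2 * x 0 i * t + t ^+ 2)
  - e * (2 * x 0 i * t + t * t)
  + (if i \in A then c * radius (~: A) x else - (c * radius A x))
  - e * \sum_j x 0 j ^+ 2.
Proof.
rewrite /excess line_sum !radius_line finset.in_setC.
by case: ifPn => iA /=; ring.
Qed.

(** Summing the coordinate tests gives an identity for the squared gradient and an inequality for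
    the Laplacian; [dhE] and the equation for [u] then eliminate all derivatives of [u]. The left
    side keeps the term [h * k], while the right side is of order [e]. *)
Lemma touching_sum e x (r0 : R) : 0 < radius (~: A) x <= radius A x -> 0 < r0 ->
  0 < e -> (forall i t, `|t| < r0 -> excess c e (line x i t) <= excess c e x) ->
  h (u x) * (k (u x) + (f (u x) + k (u x)) *
     (4 * e * (c * (radius A x - radius (~: A) x) + e * \sum_i x 0 i ^+ 2)))
  <= 2 * e * n%:R.
Proof.
move=> /andP[t0 ts] r00 e0 Fmax.
set s := radius A x in ts *; set t := radius (~: A) x in t0 ts *.
have s0 : 0 < s by apply: lt_le_trans ts.
pose ci i : R := if i \in A then c else - c.
pose ri i : R := if i \in A then s else t.
have ri0 i : 0 < ri i by rewrite /ri; case: ifP.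
have touch i : h (u x) * partial i u x = (ci i / ri i + 2 * e) * x 0 i /\
    dh (u x) * partial i u x ^+ 2 + h (u x) * partial i (partial i u) x
    <= ci i * ((ri i)^-1 - x 0 i ^+ 2 / ri i ^+ 3) + 2 * e.
  apply: touching_coordinate (ri0 i) r00 _ => y /(Fmax i).
  rewrite excess_line /excess -/s -/t /ci /ri; case: ifP => _; lra.
pose S := \sum_i partial i u x ^+ 2.
(* Because [2 * c ^+ 2 = 1], the gradient of [c * (s - t)] has norm [1]; the other terms come from
   the penalty. *)
have first_order : h (u x) ^+ 2 * S =
    1 + 4 * e * (c * (s - t) + e * \sum_i x 0 i ^+ 2).
  rewrite sum_sqr_radius /S [LHS]mulr_sumr.
  under eq_bigr => i _ do rewrite -exprMn (proj1 (touch i)) exprMn.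
  have <- : (c / s + 2 * e) ^+ 2 * s ^+ 2 + (- c / t + 2 * e) ^+ 2 * t ^+ 2 =
      1 + 4 * e * (c * (s - t) + e * (s ^+ 2 + t ^+ 2)).
    by rewrite -[X in _ = X + _]cE; field; rewrite !gt_eqF.
  rewrite sum_split !sqr_radius !mulr_sumr; congr (_ + _); apply: eq_bigr => i.
    by move=> iA; rewrite /ci /ri iA.
  by rewrite finset.in_setC /ci /ri => /negbTE ->.
(* This is the superharmonicity of the distance: both blocks have the same dimension [d], so
   [c * (s - t)] has Laplacian [c * (d - 1) * (1/s - 1/t)], nonpositive for [t <= s]. The penalty
   contributes [2 * e * n]. *)
have second_order : dh (u x) * S + h (u x) * laplacian u x <= 2 * e * n%:R.
  rewrite /laplacian !mulr_sumr -big_split/=.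
  apply: (@le_trans _ _ (\sum_i (ci i * ((ri i)^-1 - x 0 i ^+ 2 / ri i ^+ 3) + 2 * e))).
    by apply: ler_sum => i _; case: (touch i).
  rewrite big_split/= sumr_const card_ord -[2 * e *+ n]mulr_natr gerDr.
  have -> : \sum_i ci i * ((ri i)^-1 - x 0 i ^+ 2 / ri i ^+ 3) =
      c / s *+ #|A| - c / s ^+ 3 * s ^+ 2 +
      (- c / t *+ #|~: A| + c / t ^+ 3 * t ^+ 2).
    rewrite sum_split !sqr_radius !mulr_sumr -!sumr_const -sumrN -!big_split/=.
    congr (_ + _); apply: eq_bigr => i.
      by move=> iA; rewrite /ci /ri iA; ring.
    by rewrite finset.in_setC /ci /ri => /negbTE ->; ring.
  rewrite cardA.
  rewrite -(prednK A_neq0); set m := #|_|.-1.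
  have -> : c / s *+ m.+1 - c / s ^+ 3 * s ^+ 2 + (- c / t *+ m.+1 + c / t ^+ 3 * t ^+ 2)
      = m%:R * c * (s^-1 - t^-1).
    rewrite -(mulr_natr (c / s)) -(mulr_natr (- c / t)) -natr1.
    by field; rewrite !gt_eqF.
  rewrite mulr_ge0_le0// ?mulr_ge0// ?(ltW c_gt0)//.
  by rewrite subr_le0 lef_pV2// posrE.
have lap : laplacian u x = - f (u x) by rewrite -u_sol opprK.
move: second_order; rewrite lap dhE.
have -> : h (u x) ^+ 3 * (f (u x) + k (u x)) * S + h (u x) * - f (u x) =
  h (u x) * ((f (u x) + k (u x)) * (h (u x) ^+ 2 * S) - f (u x)) by ring.
rewrite first_order; set rho := 4 * e * _.
suff -> : (f (u x) + k (u x)) * (1 + rho) - f (u x) =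
  k (u x) + (f (u x) + k (u x)) * rho by [].
by ring.
Qed.

(** A positive excess forces [e * |x|^2] below [H K], so a positive value yields a maximum over a
    compact set. There [u > 0], so the maximum lies strictly off the cone, and the smallness of [e]
    contradicts [touching_sum]. *)
Lemma excess_le0 e x : 0 < e -> radius (~: A) x <= radius A x ->
  (forall v, 0 <= v <= K -> e * (2 * n%:R + 4 * h v * `|f v| * H v) < h v * k v) ->
  excess c e x <= 0.
Proof.
move=> e0 xA hK; rewrite leNgt; apply/negP => x_pos.
have excess_lt y : radius (~: A) y <= radius A y -> 0 < excess c e y ->
    c * (radius A y - radius (~: A) y) + e * \sum_i y 0 i ^+ 2 < H (u y).
  by rewrite /excess; lra.
have d_ge0 y : radius (~: A) y <= radius A y ->
    0 <= c * (radius A y - radius (~: A) y).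
  by move=> yA; rewrite mulr_ge0 ?subr_ge0// ltW.
have N_ge0 y : 0 <= \sum_i (y : 'rV[R]_n) 0 i ^+ 2.
  by rewrite sumr_ge0// => i _; exact: sqr_ge0.
have csum : continuous (fun y : 'rV[R]_n => \sum_i y 0 i ^+ 2).
  under eq_fun do rewrite sum_sqrT.
  exact: continuous_sum_sqr.
pose S := [set y | 0 <= radius A y - radius (~: A) y] `&`
  [set y | e * \sum_i y 0 i ^+ 2 <= H K].
have clS : closed S.
  apply: closedI.
    apply: (closed_comp (f := fun y => radius A y - radius (~: A) y)) (@closed_ge _ _).
    by move=> y _; exact: (cvgB (@continuous_radius R n A y) (@continuous_radius R n (~: A) y)).
  apply: (closed_comp (f := fun y : 'rV[R]_n => e * \sum_i y 0 i ^+ 2)) (@closed_le _ _).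
  by move=> y _; exact: (cvgM (cvg_cst e) (csum y)).
have S_bnd y : S y -> forall i, `|y 0 i| <= H K / e + 1.
  move=> [_ /= yK] i.
  have : y 0 i ^+ 2 <= H K / e.
    rewrite ler_pdivlMr// mulrC; apply: le_trans yK; rewrite ler_pM2l//.
    by rewrite (bigD1 i)//= lerDl sumr_ge0// => j _; exact: sqr_ge0.
  by rewrite -real_normK ?num_real//; have := normr_ge0 (y 0 i); nra.
have cptS := compact_in_box clS S_bnd.
have Sx : S x.
  split; rewrite /= ?subr_ge0//.
  apply: le_trans (H_homo (u_le x)); apply: ltW; apply: le_lt_trans (excess_lt x xA x_pos).
  by rewrite lerDr d_ge0.
have cont : {within S, continuous (excess c e)}.
  apply: continuous_subspaceT => y.
  have cHu : {for y, continuous (fun y => H (u y))}.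
    apply: (@continuous_comp _ _ _ u H); first exact: differentiable_continuous.
    exact: is_derive_continuous (H' _).
  apply: (cvgB (cvgB cHu (cvgM (cvg_cst c) (cvgB (@continuous_radius R n A y)
    (@continuous_radius R n (~: A) y)))) (cvgM (cvg_cst e) (csum y))).
have [y /set_mem[/=]] := compact_EVT_max (ex_intro _ x Sx) cptS cont.
rewrite subr_ge0 => yA yK ymax.
have y_pos : 0 < excess c e y by apply: lt_le_trans x_pos _; apply: ymax; exact: mem_set.
(* On this side of the cone, outside the compact set, the penalty exceeds [H K] and the excess is
   negative. *)
have ymax' z : radius (~: A) z <= radius A z -> excess c e z <= excess c e y.
  move=> zA; have [zK|zK] := leP (e * \sum_i z 0 i ^+ 2) (H K).
    by apply: ymax; apply: mem_set; split; rewrite //= subr_ge0.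
  apply: ltW; apply: le_lt_trans y_pos; rewrite /excess.
  by have := d_ge0 z zA; have := H_homo (u_le z); lra.
have Huy := excess_lt y yA y_pos.
have uy0 : 0 < u y.
  rewrite ltNge; apply/negP => /H_homo; rewrite H0 leNgt => /negP; apply.
  by apply: le_lt_trans Huy; rewrite addr_ge0 ?d_ge0// mulr_ge0// ltW.
have ysep : radius (~: A) y < radius A y.
  rewrite lt_neqAle yA andbT; apply/eqP => /esym/u_cone uy.
  by rewrite uy ltxx in uy0.
have [r0 r00 near_y] : exists2 r0, 0 < r0 &
    forall i t, `|t| < r0 -> radius (~: A) (line y i t) <= radius A (line y i t).
  have : \forall t \near (0 : R), forall i,
      0 < radius A (line y i t) - radius (~: A) (line y i t).
    apply: (@filter_forall _ _ (fun i (t : R) =>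
      is_true (0 < radius A (line y i t) - radius (~: A) (line y i t))) (nbhs (0 : R)) _ _) => i.
    have cr (B : {set 'I_n}) : radius B (line y i t) @[t --> (0 : R)] --> radius B y.
      rewrite -{2}(line0 y i); apply: (@continuous_comp _ _ _ (line y i) (radius B)).
        exact: continuous_line.
      exact: continuous_radius.
    by apply: (cvgr_gt _ (cvgB (cr A) (cr (~: A)))); rewrite subr_gt0.
  move=> /nbhs_ballP[r0 /= r00 hr]; exists r0 => // i t tr.
  by rewrite ltW// -subr_gt0; apply: hr; rewrite /ball/= sub0r normrN.
have line_max i t : `|t| < r0 -> excess c e (line y i t) <= excess c e y.
  by move=> tr; apply: ymax'; exact: near_y tr.
(* The distance is not differentiable where [radius (~: A)] vanishes, but its
   kink there is concave and excludes a maximum of [excess]. *)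
have [t0|t0] := eqVneq (radius (~: A) y) 0.
  have [j jA] : exists j, j \in ~: A by apply/card_gt0P.
  have jA' : j \in A = false by move: jA; rewrite finset.in_setC => /negbTE.
  have yj : y 0 j = 0.
    apply/eqP; rewrite -sqrf_eq0 eq_le sqr_ge0 andbT.
    suff : y 0 j ^+ 2 <= radius (~: A) y ^+ 2 by rewrite t0 expr0n.
    by rewrite sqr_radius (bigD1 j)//= lerDl sumr_ge0// => l _; exact: sqr_ge0.
  pose F t := H (u (line y j t)) - e * (t * t).
  have F' t : is_derive t 1 F (h (u (line y j t)) * partial j u (line y j t) - e * (t + t)).
    apply: is_derive_sub; first exact: is_derive_Hu.
    apply: is_derive_scale; apply: (is_derive_eq
      (is_derive_mul (is_derive_id t 1) (is_derive_id t 1))).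
    by rewrite /=; ring.
  apply: (local_max_no_kink r00 c_gt0 (fun t _ => @ex_derive _ _ _ _ _ _ _ (F' t)) (F' 0)).
  move=> t; rewrite !subr0 => /(line_max j).
  rewrite excess_line /excess jA' yj t0 /F line0 expr0n/= mulr0 mul0r addr0 add0r sqrtr_sqr.
  by lra.
have t_pos : 0 < radius (~: A) y <= radius A y.
  by rewrite lt_neqAle eq_sym t0 radius_ge0.
have := touching_sum t_pos r00 e0 line_max.
have uyK : 0 <= u y <= K by rewrite u_le ltW.
have := hK _ uyK.
(* Positivity of the excess says that [q], distance plus penalty, is below [H w]. It remains to drop
   the nonnegative term in [k w * q] and to bound [f w] below by its negated absolute value. *)
set w := u y in Huy *; set q := _ + _ in Huy *.
have q0 : 0 <= q by rewrite addr_ge0 ?d_ge0// mulr_ge0// ltW.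
have hw := h_gt0 w; have kw := k_gt0 w.
have fw : - (`|f w|) <= f w by rewrite lerNnormlW.
have : 0 <= 4 * e * h w * (k w * q) by rewrite !mulr_ge0// ltW.
have : 4 * e * h w * (`|f w| * q) <= 4 * e * h w * (`|f w| * H w).
  by rewrite ler_wpM2l ?mulr_ge0 ?(ltW hw) ?(ltW e0)// ler_wpM2l// ltW.
have : 4 * e * h w * (- `|f w| * q) <= 4 * e * h w * (f w * q).
  by rewrite ler_wpM2l ?mulr_ge0 ?(ltW hw) ?(ltW e0)// ler_wpM2r.
lra.
Qed.

(** The penalty is removed by taking [e] small: a violation at [x] would leave the excess at [x]
    positive. *)
Lemma comparison x : radius (~: A) x <= radius A x ->
  H (u x) <= c * (radius A x - radius (~: A) x).
Proof.
move=> xA; rewrite leNgt; apply/negP => x_gt.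
have K0 : 0 <= K.
  have r0 B : radius B 0 = 0.
    rewrite /radius big1 ?sqrtr0// => i _; by rewrite mxE expr0n.
  by rewrite -(u_cone (x := 0)) ?r0.
pose q (v : R) := (2 * n%:R + 4 * h v * `|f v| * H v) / (h v * k v).
have cq : {within `[0, K], continuous q}.
  apply: continuous_subspaceT => v.
  have ch := is_derive_continuous (h' v).
  have cH := is_derive_continuous (H' v).
  have cfv : {for v, continuous (fun v => `|f v|)} by apply: cvg_norm; exact: cf.
  have cnum : {for v, continuous (fun v => 2 * n%:R + 4 * h v * `|f v| * H v)}.
    by apply: cvgD; [exact: cvg_cst|apply: (cvgM (cvgM (cvgM _ ch) cfv) cH); exact: cvg_cst].
  have hk_neq0 : h v * k v != 0 by rewrite gt_eqF// mulr_gt0.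
  exact: (cvgM cnum (cvgV hk_neq0 (cvgM ch (@ck v)))).
have [v0 _ qmax] := EVT_max K0 cq.
pose N := \sum_i x 0 i ^+ 2.
have N0 : 0 <= N by rewrite sumr_ge0// => i _; exact: sqr_ge0.
pose gap := H (u x) - c * (radius A x - radius (~: A) x).
have gap0 : 0 < gap by rewrite subr_gt0.
(* The first bound keeps the penalty at [x] below [gap]; the second gives the smallness condition of
   [excess_le0], through the maximum of the ratio [q] on [[0, K]]. *)
pose e := Num.min (gap / (N + 1) / 2) (`|q v0| + 1)^-1.
have q1 : 0 < `|q v0| + 1 by rewrite ltr_wpDl.
have N1 : 0 < N + 1 by rewrite ltr_wpDl.
have e0 : 0 < e by rewrite lt_min invr_gt0 q1 !divr_gt0.
have eN : e * N < gap.
  have : e <= gap / (N + 1) / 2 by rewrite ge_min lexx.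
  rewrite -mulrA -invfM ler_pdivlMr ?mulr_gt0//; nra.
have eq : e * (`|q v0| + 1) <= 1.
  by rewrite -ler_pdivlMr// div1r ge_min lexx orbT.
have := excess_le0 e0 xA.
suff hK : forall v, 0 <= v <= K -> e * (2 * n%:R + 4 * h v * `|f v| * H v) < h v * k v.
  move=> /(_ hK); rewrite /excess -/N leNgt => /negP; apply.
  by rewrite /gap in eN; lra.
move=> v vK; have hk0 : 0 < h v * k v by rewrite mulr_gt0.
rewrite -[ltRHS]mul1r -ltr_pdivrMr// -[ltLHS]mulrA -/(q v).
have : q v <= `|q v0| by apply: le_trans (ler_norm _); apply: qmax; rewrite in_itv.
by rewrite -(ler_pM2l e0); move: eq; rewrite mulrDr mulr1; lra.
Qed.

End comparison.

(** * The strict bound by [M] on one side of the cone, and the parity of [f'] *)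

Section bounds.
Context {R : realType}.
Variables (f : R -> R) (M : R).
Hypothesis M_gt0 : 0 < M.
Hypothesis f_C1 : C1_real f.
Hypothesis f_odd : forall v : R, f (- v) = - f v.
Hypothesis G_ge0 : forall v : R, 0 <= potential f M v.

Lemma C1_real_continuous : continuous f.
Proof.
move=> v; apply: (@is_derive_continuous _ _ _ (derive1 f v)).
by split; [exact: (f_C1.1 v)|rewrite derive1E].
Qed.

(** The profile is chosen after the point [x], with [H M] larger than the distance from [x] to the
    cone; [M <= u x] would then contradict [comparison]. *)
Lemma solution_lt n (A : {set 'I_n}) (u : 'rV[R]_n -> R) (K : R) :
  continuously_differentiable 2 u -> (forall x, - laplacian u x = f (u x)) ->
  (forall x, u x <= K) ->
  (forall x, radius A x = radius (~: A) x -> u x = 0) ->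
  #|A| = #|~: A| -> (0 < #|~: A|)%N ->
  forall x, radius (~: A) x <= radius A x -> u x < M.
Proof.
move=> [du d2u] u_sol u_le u_cone cardA A0 x xA.
have cf := C1_real_continuous.
have [F _ F'] := antiderivative_exists cf.
have GE (v : R) : potential f M v = F M - F v by exact: oriented_integralE.
have G' (v : R) : is_derive v 1 (fun v => F M - F v) (- f v).
  by rewrite -sub0r; exact: (is_derive_sub (is_derive_cst (F M) v 1) (F' v)).
have G0 (v : R) : 0 <= F M - F v by rewrite -GE.
have GM : F M - F M = 0 by rewrite subrr.
pose c : R := (Num.sqrt 2)^-1.
have c0 : 0 < c by rewrite invr_gt0 sqrtr_gt0.
have cE : 2 * c ^+ 2 = 1 by rewrite exprVn sqr_sqrtr// divff.
have [H [h [k [k0 HM [H0 H' h0 h']]]]] := supersolution_profile_slow G' G0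
  (c * (radius A x - radius (~: A) x)) M_gt0 f_C1 GM.
rewrite ltNge; apply/negP => Mu.
have : H M <= H (u x).
  by apply: (derive_nondecreasing Mu (fun v _ => H' v)) => v _; exact: ltW.
apply/negP; rewrite -ltNge; apply: le_lt_trans HM.
apply: (@comparison R n A u H h _ du _ H' h' f (fun v => k * expR (- v)) K) => //.
- by move=> i y; exact: (d2u i).1.
- move=> v; apply: is_derive_continuous; exact/is_derive_scale/is_derive_expRN.
- by move=> v; rewrite mulr_gt0// expR_gt0.
Qed.

Lemma derive1_even (v : R) : derive1 f (- v) = derive1 f v.
Proof.
have f' (w : R) : is_derive w 1 f (derive1 f w).
  by split; [exact: (f_C1.1 w)|rewrite derive1E].
have := is_deriveN (is_derive1_comp (f' (- v)) (is_deriveNid v 1)).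
rewrite mulrN1 opprK (_ : - (f \o -%R) = f); last first.
  by apply/funext => w; rewrite /GRing.opp/= f_odd opprK.
by move=> [_ <-]; rewrite -derive1E.
Qed.

End bounds.

(** * The two blocks of coordinates and the bound on both sides of the cone *)

Section blocks.
Context {R : realType} (m : nat).
Implicit Types (x : 'rV[R]_(m + m)) (u : 'rV[R]_(m + m) -> R).

Definition first_block : {set 'I_(m + m)} := [set i : 'I_(m + m) | (i < m)%N]%SET.

Lemma sum_first_block (V : nmodType) (F : 'I_(m + m) -> V) :
  \sum_(i in first_block) F i = \sum_(i < m) F (lshift m i).
Proof.
rewrite big_mkcond big_split_ord/= [X in _ + X]big1 ?addr0.
  by apply: eq_bigr => i _; rewrite inE/= ltn_ord.
by move=> i _; rewrite inE/= ltnNge leq_addr.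
Qed.

Lemma sum_second_block (V : nmodType) (F : 'I_(m + m) -> V) :
  \sum_(i in ~: first_block) F i = \sum_(i < m) F (rshift m i).
Proof.
rewrite big_mkcond big_split_ord/= big1 ?add0r.
  by apply: eq_bigr => i _; rewrite !inE/= ltnNge leq_addr.
by move=> i _; rewrite !inE/= ltn_ord.
Qed.

Lemma cone_sE x : cone_s x = radius first_block x.
Proof.
by rewrite /radius sum_first_block; congr Num.sqrt; apply: eq_bigr => i _; rewrite mxE.
Qed.

Lemma cone_tE x : cone_t x = radius (~: first_block) x.
Proof.
by rewrite /radius sum_second_block; congr Num.sqrt; apply: eq_bigr => i _; rewrite mxE.
Qed.

Lemma card_first_block : #|first_block| = m.
Proof. by rewrite -sum1_card; rewrite (sum_first_block (fun=> 1%N)) sum1_card card_ord. Qed.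

Lemma card_second_block : #|~: first_block| = m.
Proof. by rewrite -sum1_card; rewrite (sum_second_block (fun=> 1%N)) sum1_card card_ord. Qed.

Lemma continuously_differentiable2N u :
  continuously_differentiable 2 u -> continuously_differentiable 2 (fun x => - u x).
Proof.
have pN (g : 'rV[R]_(m + m) -> R) i : (forall x, differentiable g x) ->
    partial i (fun x => - g x) = (fun x => - partial i g x).
  by move=> dg; apply/funext => x; rewrite /partial deriveN//; exact: diff_derivable.
move=> [du d2u]; split; first by move=> x; exact: differentiableN.
move=> i; rewrite pN//; split; first by move=> x; apply/differentiableN/(d2u i).1.
move=> j; rewrite pN; last exact: (d2u i).1.
by move=> x; exact: (continuousN ((d2u i).2 j x)).
Qed.

Lemma laplacianN u x : continuously_differentiable 2 u ->
  laplacian (fun x => - u x) x = - laplacian u x.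
Proof.
move=> [du d2u]; rewrite /laplacian -sumrN; apply: eq_bigr => i _.
have -> : partial i (fun x => - u x) = (fun x => - partial i u x).
  by apply/funext => y; rewrite /partial deriveN//; exact: diff_derivable.
by rewrite /partial deriveN//; apply: diff_derivable; exact: (d2u i).1.
Qed.

Lemma solution_bound (f : R -> R) (M : R) u : (0 < m)%N -> 0 < M -> C1_real f ->
  (forall v : R, f (- v) = - f v) -> (forall v : R, 0 <= potential f M v) ->
  classical_solution f u -> bounded_fun u ->
  (forall x, simons_cone x -> u x = 0) -> same_sign_s_minus_t u ->
  forall x, `|u x| < M.
Proof.
move=> m0 M0 fC1 fodd G0 [uC2 usol] ubnd ucone [upos uneg] x.
have [K Ku] : exists K, forall y, `|u y| <= K.
  have [K [_ hK]] := ubnd; exists (K + 1) => y.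
  by apply: (hK (K + 1)) => //; rewrite ltrDl.
have cone_eq y : radius first_block y = radius (~: first_block) y -> u y = 0.
  by rewrite -cone_sE -cone_tE => /ucone.
have [h|/ltW h] := leP (cone_t x) (cone_s x).
- have u0 : 0 <= u x.
    move: h; rewrite le_eqVlt => /predU1P[/esym h|/upos/ltW//].
    by rewrite ucone.
  rewrite ger0_norm//.
  apply: (solution_lt M0 fC1 G0 (A := first_block) (K := K) uC2 usol) => //.
  + by move=> y; apply: le_trans (Ku y); exact: ler_norm.
  + by rewrite card_first_block card_second_block.
  + by rewrite card_second_block.
  + by rewrite -cone_sE -cone_tE.
- have u0 : u x <= 0.
    move: h; rewrite le_eqVlt => /predU1P[h|/uneg/ltW//].
    by rewrite ucone.
  rewrite ler0_norm//.
  have cK : (~: ~: first_block = first_block)%SET by exact: finset.setCK.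
  (* As [f] is odd, [- u] solves the same equation; exchanging the blocks turns [s <= t] into the
     side already treated. *)
  apply: (solution_lt M0 fC1 G0 (A := (~: first_block)%SET) (K := K)
    (u := fun x => - u x) (continuously_differentiable2N uC2)); rewrite ?cK.
  + by move=> y; rewrite laplacianN// usol fodd.
  + by move=> y; apply: le_trans (Ku y); rewrite -normrN; exact: ler_norm.
  + by move=> y /esym/cone_eq ->; rewrite oppr0.
  + by rewrite card_first_block card_second_block.
  + by rewrite card_first_block.
  + by rewrite -cone_sE -cone_tE.
Qed.

End blocks.

(** * Integration over R^n *)

Section tuple_integral.
Context {R : realType}.
Local Notation TR := (measurableTypeR R).
Local Notation mu n := (lebesgue_tuple R n).

Definition row_of_tuple n (t : n.-tuple TR) : 'rV[R]_n := \row_i (tnth t i : R).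

Definition box n (B : R) : set (n.-tuple TR) :=
  [set t | forall i, (`[- B, B]%classic : set TR) (tnth t i)].

Lemma measurable_forall_tnth n (A : 'I_n -> set TR) :
  (forall i, measurable (A i)) ->
  measurable [set t : n.-tuple TR | forall i, A i (tnth t i)].
Proof.
move=> mA; rewrite (_ : [set t | _] = \big[setI/setT]_(i < n)
    ((fun t : n.-tuple TR => tnth t i) @^-1` A i)).
  apply: bigsetI_measurable => i _.
  by rewrite -[X in measurable X]setTI; exact: measurable_tnth.
apply/seteqP; split=> t /= At.
  by elim/big_rec: _ => // i D _ tD; split => //; exact: At.
by move=> i; move: At; rewrite (bigD1 i)//= => -[].
Qed.

Lemma measurable_box n B : measurable (@box n B).
Proof.
apply: (@measurable_forall_tnth n (fun=> `[- B, B]%classic)) => i.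
exact: measurable_itv.
Qed.

Lemma lebesgue_tuple_box_fin n B : (mu n (@box n B) < +oo)%E.
Proof.
pose I : set TR := `[- B, B]%classic.
rewrite /box (lebesgue_tuple_box (A := fun=> I)); last first.
  by move=> i; exact: measurable_itv.
suff : (\prod_(i < n) @lebesgue_measure R I)%E \is a fin_num.
  by rewrite fin_numE => /andP[_]; rewrite ltey.
elim/big_ind: _ => [|x y|i _] //; first exact: fin_numM.
by rewrite /I lebesgue_measure_itv/=; case: ifPn => // _; rewrite -EFinB.
Qed.

(** An open set is a countable union of cubes with rational centres, and each cube is a product of
    intervals, hence measurable for the product sigma-algebra. *)
Lemma measurable_preimage_row n (U : set 'rV[R]_n) : open U ->
  measurable (@row_of_tuple n @^-1` U).
Proof.
move=> oU.
have near_rat (a w : R) : 0 < w -> exists q : rat, `|a - ratr q| < w.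
  move=> w0; have lt1 : a - w < a + w by lra.
  have [q] := rat_in_itvoo lt1; rewrite in_itv/= => /andP[q1 q2]; exists q.
  by rewrite ltr_norml; apply/andP; split; lra.
have tri (a b c w e : R) : `|a - c| < w -> `|b - c| < w -> w < e / 2 -> `|a - b| < e.
  move=> ac bc we; rewrite (_ : a - b = (a - c) - (b - c)); last by ring.
  by apply: le_lt_trans (ler_normB _ _) _; lra.
pose cube (p : {ffun 'I_n -> rat} * nat) : set 'rV[R]_n :=
  [set x | forall i, `|x 0 i - ratr (p.1 i)| < p.2.+1%:R^-1].
(* Cubes that leave [U] are replaced by [set0], so that the union runs over a whole countable
   type. *)
pose good p := if pselect (cube p `<=` U) is left _ then cube p else set0.
have -> : @row_of_tuple n @^-1` U = \bigcup_p (@row_of_tuple n @^-1` good p).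
  apply/seteqP; split=> t /=; last first.
    by move=> [p _]; rewrite /good /preimage/=; case: pselect => // cU /cU.
  move=> Ut; have /nbhs_ballP[e /= e0 eU] : nbhs (row_of_tuple t) U.
    exact: open_nbhs_nbhs.
  (* A cube of half-width below [e / 2] that contains the point lies in the ball of radius [e]
     around it. *)
  have [k ke] : exists k : nat, k.+1%:R^-1 < e / 2.
    have e2 : 0 < e / 2 by rewrite divr_gt0.
    exists (Num.bound (e / 2)^-1).
    rewrite -[ltRHS]invrK ltf_pV2 ?posrE ?ltr0n ?invr_gt0//.
    apply: lt_le_trans (archi_boundP _) _; first by rewrite invr_ge0 ltW.
    by rewrite ler_nat.
  have k0 : 0 < k.+1%:R^-1 :> R by rewrite invr_gt0 ltr0n.
  pose q := [ffun i => projT1 (cid (near_rat (tnth t i) _ k0))].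
  exists (q, k) => //; rewrite /good /preimage/=; case: pselect => [_|].
    by move=> i; rewrite mxE /= ffunE; case: cid.
  case=> x xq; apply: eU; split=> // i j; rewrite ord1 /ball/= mxE.
  have := xq j; rewrite /= ffunE; case: cid => r /= ar xr.
  exact: tri ar xr ke.
apply: (countable_bigcupT_measurable (countableP _)) => p.
rewrite /good; case: pselect => _; last by rewrite preimage_set0.
rewrite (_ : _ @^-1` _ = [set t : n.-tuple TR | forall i,
    ([set x | `|x - ratr (p.1 i)| < p.2.+1%:R^-1] : set TR) (tnth t i)]).
  apply: (@measurable_forall_tnth n (fun i =>
    [set x : TR | `|x - ratr (p.1 i)| < p.2.+1%:R^-1])) => i.
  rewrite (_ : [set x | _] =
      `]ratr (p.1 i) - p.2.+1%:R^-1, ratr (p.1 i) + p.2.+1%:R^-1[).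
    exact: measurable_itv.
  by apply/seteqP; split=> x /=; rewrite in_itv/= ltr_distl.
by apply/seteqP; split=> t /= tp i; have := tp i; rewrite mxE.
Qed.

Lemma continuous_measurable_tuple n (g : 'rV[R]_n -> R) : continuous g ->
  measurable_fun setT (fun t => g (@row_of_tuple n t)).
Proof.
move=> cg; apply: (measurability _ (RGenOpens.measurableE R)).
move=> _ [_ [a [b ->] <-]]; rewrite setTI.
have oU : open (g @^-1` `]a, b[).
  by apply: open_comp; [move=> x _; exact: cg|exact: interval_open].
exact: measurable_preimage_row oU.
Qed.

Lemma integrable_bounded_support d (T : measurableType d)
    (nu : {measure set T -> \bar R}) (h : T -> R) (D : set T) (C : R) :
  measurable D -> (nu D < +oo)%E -> measurable_fun setT h ->
  (forall t, `|h t| <= C) -> (forall t, ~ D t -> h t = 0) ->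
  nu.-integrable setT (EFin \o h).
Proof.
move=> mD Dfin mh hC h0.
have -> : EFin \o h = (EFin \o h) \_ D.
  apply/funext => t; rewrite patchE; case: ifPn => //= /negP tD.
  by rewrite h0// => Dt; apply: tD; rewrite inE.
apply: (iffLR (integrable_mkcond _ mD)).
apply: (measurable_bounded_integrable mD Dfin); first exact: measurable_funS mh.
exists C; split; first exact: num_real.
by move=> y Cy t _; apply: le_trans (hC t) (ltW Cy).
Qed.

Definition tuple_update n (t : n.-tuple TR) (i : 'I_n) (a : TR) : n.-tuple TR :=
  [tuple (if j == i then a else tnth t j) | j < n].

(** Fubini, by induction on the dimension: if [i] is not the first coordinate, the first one is
    frozen; otherwise it is integrated first. Boundedness and the support in a box give
    integrability and pass to the slices. *)
Lemma integral_slices0 n (i : 'I_n) (h : n.-tuple TR -> R) (B C : R) :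
  measurable_fun setT h -> (forall t, `|h t| <= C) ->
  (forall t, ~ box B t -> h t = 0) ->
  (forall t, (\int[lebesgue_measure]_a (h (tuple_update t i a))%:E = 0)%E) ->
  (\int[mu n]_t (h t)%:E = 0)%E.
Proof.
elim: n i h => [[]//|n IH] i h mh hC h0 hs.
have mc := @measurable_tuple_cons R n.
have intc : (@lebesgue_measure R \x mu n)%E.-integrable setT
    ((EFin \o h) \o @tuple_cons R n).
  apply: (@integrable_bounded_support _ _ _ (h \o @tuple_cons R n)
    (@tuple_cons R n @^-1` box B) C) => //.
  - by rewrite -[X in measurable X]setTI; apply: mc => //; exact: measurable_box.
  - exact: (lebesgue_tuple_box_fin n.+1 B).
  - exact: measurableT_comp.
  - by move=> t; exact: hC.
  - by move=> t tD; exact: (h0 (tuple_cons t)) tD.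
have -> : (\int[mu n.+1]_t (h t)%:E =
    \int[@lebesgue_measure R \x mu n]_p (h (tuple_cons p))%:E)%E.
  rewrite /= /tuple_cons_measure integral_pushforward//.
  exact/measurable_EFinP.
case: (unliftP ord0 i) hs => [j ->|->] hs.
- rewrite -(integral12_prod_meas1 intc) /fubini_F/=.
  apply: integral0_eq => a _; apply: (IH j (fun t => h (tuple_cons (a, t)))) => //.
  + apply: (measurableT_comp mh); apply: (measurableT_comp mc).
    exact: measurable_pair1.
  + move=> t tB; apply: h0 => tcB; apply: tB => l.
    have := tcB (lift ord0 l); rewrite /tuple_cons tnthS.
    by congr (_ (tnth _ _)); exact: val_inj.
  + move=> t; rewrite -[RHS](hs (tuple_cons (a, t))).
    apply: eq_integral => b _; congr (h _)%:E; apply: eq_from_tnth => l.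
    rewrite [RHS]tnth_mktuple; have [l' ->|->] := unliftP ord0 l.
      by rewrite (inj_eq lift_inj) !tnthS /= tnth_mktuple.
    by rewrite (negbTE (neq_lift _ _)).
- rewrite -(integral21_prod_meas1 intc) /fubini_G/=.
  (* The entry [0] is arbitrary, since the update overwrites it. *)
  apply: integral0_eq => t _; rewrite -[RHS](hs (tuple_cons (0, t))).
  apply: eq_integral => a _; congr (h _)%:E; apply: eq_from_tnth => l.
  rewrite [RHS]tnth_mktuple; have [l' ->|->] := unliftP ord0 l.
    by rewrite eq_sym (negbTE (neq_lift _ _)) /= !tnthS.
  by rewrite eqxx.
Qed.

End tuple_integral.

(** * Integrals of continuous functions supported in a box, and integration by parts *)

Section euclidean_integral_theory.
Context {R : realType} {n : nat}.
Local Notation TR := (measurableTypeR R).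
Implicit Types (g : 'rV[R]_n -> R) (x : 'rV[R]_n) (i : 'I_n).

(** With [B] fixed, this class is closed under sums and multiples, and its members are
    integrable. *)
Definition continuous_in_box (B : R) g :=
  continuous g /\ forall x i, B < `|x 0 i| -> g x = 0.

Lemma continuous_in_boxD B g1 g2 : continuous_in_box B g1 ->
  continuous_in_box B g2 -> continuous_in_box B (fun x => g1 x + g2 x).
Proof.
move=> [c1 s1] [c2 s2]; split.
  by move=> x; exact: (cvgD (@c1 x) (@c2 x)).
by move=> x i xi; rewrite (s1 x i)// (s2 x i)// addr0.
Qed.

Lemma continuous_in_boxZ B (k : R) g : continuous_in_box B g ->
  continuous_in_box B (fun x => k * g x).
Proof.
move=> [c1 s1]; split; last by move=> x i xi; rewrite (s1 x i)// mulr0.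
by move=> x; exact: (cvgM (cvg_cst k) (@c1 x)).
Qed.

Lemma bounded_in_box B g : 0 <= B -> continuous_in_box B g ->
  exists C, forall x, `|g x| <= C.
Proof.
move=> B0 [cg sg].
pose Q : set 'rV[R]_n := [set x | forall i, `[- B, B]%classic (x 0 i)].
have cpt : compact Q.
  by apply: (@rV_compact _ _ (fun=> `[- B, B]%classic)) => _; exact: segment_compact.
have ne : Q !=set0 by exists 0 => i /=; rewrite mxE in_itv/= oppr_le0 B0.
have cng : {within Q, continuous (fun x => `|g x|)}.
  by apply: continuous_subspaceT => x; exact: (cvg_norm (@cg x)).
have [x0 _ gmax] := compact_EVT_max ne cpt cng.
exists `|g x0| => x; have [xB|/existsNP[i /negP xB]] := pselect (Q x).
  by apply: gmax; rewrite inE.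
rewrite (sg _ i) ?normr0//.
by move: xB; rewrite /= in_itv/= -ler_norml -ltNge.
Qed.

Lemma integrable_in_box B g : 0 <= B -> continuous_in_box B g ->
  (lebesgue_tuple R n).-integrable setT (fun t => (g (row_of_tuple t))%:E).
Proof.
move=> B0 sg; have [C gC] := bounded_in_box B0 sg.
apply: (@integrable_bounded_support _ _ _ _ (fun t => g (row_of_tuple t))
  (@box R n B) C).
- exact: measurable_box.
- exact: lebesgue_tuple_box_fin.
- exact: continuous_measurable_tuple sg.1.
- by move=> t; exact: gC.
- move=> t /existsNP[i /negP]; rewrite /= in_itv/= => tB.
  by apply: (sg.2 _ i); rewrite mxE ltNge ler_norml.
Qed.

Lemma euclidean_integralD B g1 g2 : 0 <= B -> continuous_in_box B g1 ->
  continuous_in_box B g2 -> euclidean_integral (fun x => g1 x + g2 x) =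
  (euclidean_integral g1 + euclidean_integral g2)%E.
Proof.
move=> B0 s1 s2; rewrite /euclidean_integral.
under eq_integral do rewrite EFinD.
by rewrite integralD//; exact: integrable_in_box B0 _.
Qed.

Lemma euclidean_integralZ B (k : R) g : 0 <= B -> continuous_in_box B g ->
  euclidean_integral (fun x => k * g x) = (k%:E * euclidean_integral g)%E.
Proof.
move=> B0 s1; rewrite /euclidean_integral.
under eq_integral do rewrite EFinM.
by rewrite integralZl//; exact: integrable_in_box B0 _.
Qed.

Lemma euclidean_integral_fin B g : 0 <= B -> continuous_in_box B g ->
  euclidean_integral g \is a fin_num.
Proof.
by move=> B0 sg; apply: integrable_fin_num => //; exact: integrable_in_box B0 _.
Qed.

Lemma euclidean_integral_sum0 B (F : 'I_n -> 'rV[R]_n -> R) : 0 <= B ->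
  (forall i, continuous_in_box B (F i)) ->
  (forall i, euclidean_integral (F i) = 0%E) ->
  continuous_in_box B (fun x => \sum_i F i x) /\
  euclidean_integral (fun x => \sum_i F i x) = 0%E.
Proof.
move=> B0 sF F0; elim: (index_enum 'I_n) => [|i s [ss s0]].
  under eq_fun do rewrite big_nil.
  split; first by split=> //; exact: cst_continuous.
  by rewrite /euclidean_integral integral0.
under eq_fun do rewrite big_cons.
split; first exact: continuous_in_boxD.
by rewrite (euclidean_integralD B0)// F0 s0 adde0.
Qed.

Lemma integral_line0 (phi dphi : R -> R) (B : R) :
  (forall t : R, is_derive t 1 phi (dphi t)) -> continuous dphi ->
  (forall t : R, B < `|t| -> phi t = 0 /\ dphi t = 0) ->
  (\int[@lebesgue_measure R]_t (dphi t)%:E = 0)%E.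
Proof.
move=> phi' cd supp.
(* The endpoints must lie strictly outside the support, and [B] may be negative. *)
pose D : R := `|B| + 1; pose I : set R := `[- D, D]%classic.
have DB : B < D by rewrite /D (le_lt_trans (ler_norm B))// ltrDl.
have D0 : 0 < D by rewrite /D ltr_wpDl.
have nD : `|D| = D by rewrite gtr0_norm.
have -> : (\int[@lebesgue_measure R]_t (dphi t)%:E =
    \int[@lebesgue_measure R]_(t in I) (dphi t)%:E)%E.
  rewrite [RHS]integral_mkcond; apply: eq_integral => t _.
  rewrite patchE; case: ifPn => //; rewrite notin_setE /I/= in_itv/= -ler_norml.
  move=> /negP; rewrite -ltNge => tD.
  by rewrite (supp t _).2// (lt_trans DB).
rewrite /I (continuous_FTC2 (F := phi)).
- by rewrite (supp D _).1 ?nD// (supp (- D) _).1 ?normrN ?nD// subee.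
- lra.
- exact: continuous_subspaceT.
- have cphi (t : R) : {for t, continuous phi} := is_derive_continuous (phi' t).
  split; [by move=> t _; case: (phi' t)|exact: cvg_at_right_filter (cphi _)|].
  exact: cvg_at_left_filter (cphi _).
- by move=> t _; rewrite derive1E; case: (phi' t).
Qed.

(** This is the divergence theorem for one component, by Fubini and the fundamental theorem on each
    line. Only derivatives along lines in direction [i] are demanded, the form in which the flux is
    differentiated later. *)
Lemma euclidean_integral_partial0 B i g dg : 0 <= B ->
  (forall x (t : R), is_derive t 1 (fun t => g (line x i t)) (dg (line x i t))) ->
  continuous_in_box B dg -> (forall x j, B < `|x 0 j| -> g x = 0) ->
  euclidean_integral dg = 0%E.
Proof.
move=> B0 dgE sdg sg.
have [C dgC] := bounded_in_box B0 sdg.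
apply: (@integral_slices0 R n i (fun t => dg (row_of_tuple t)) B C) => //.
- exact: continuous_measurable_tuple sdg.1.
- move=> t /existsNP[j /negP]; rewrite /= in_itv/= => tB.
  by apply: (sdg.2 _ j); rewrite mxE ltNge ler_norml.
- move=> t; pose x := row_of_tuple (tuple_update t i 0).
  have xE (a : R) : row_of_tuple (tuple_update t i a) = line x i a.
    apply/rowP => j; rewrite lineE !mxE !tnth_mktuple.
    by case: ifP => _; rewrite ?add0r ?addr0.
  under eq_integral do rewrite xE.
  apply: (@integral_line0 (fun a => g (line x i a)) _ B) => //.
    by move=> a; apply: continuous_comp; [exact: continuous_line|exact: sdg.1].
  have xi : x 0 i = 0 by rewrite mxE tnth_mktuple eqxx.
  by move=> a aB; split; [apply: (sg _ i)|apply: (sdg.2 _ i)];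
    rewrite lineE eqxx xi add0r.
Qed.

End euclidean_integral_theory.

(** * Stability from a positive supersolution of the linearized equation *)

Section cutoff.
Context {R : realType}.
Implicit Types (v e : R).

Let continuous_pos : continuous (fun v : R => Num.max v 0).
Proof.
have -> : (fun v : R => Num.max v 0) = (fun v => (v + `|v|) / 2).
  by apply/funext => v; rewrite maxr_absE addr0 subr0.
move=> v; apply: cvgM; last exact: cvg_cst.
by apply: cvgD; [exact: cvg_id|apply: cvg_norm; exact: cvg_id].
Qed.

(** To avoid difference quotients at [0], an antiderivative of the continuous function
    [2 * Num.max v 0] is identified with the square by the mean value theorem. *)
Lemma is_derive_pos_sqr v :
  is_derive v 1 (fun v : R => Num.max v 0 ^+ 2) (2 * Num.max v 0).
Proof.
have c2 : continuous (fun v : R => 2 * Num.max v 0).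
  by move=> w; apply: cvgM; [exact: cvg_cst|exact: continuous_pos].
have [F F0 F'] := antiderivative_exists c2.
suff -> : (fun v : R => Num.max v 0 ^+ 2) = F by exact: F'.
apply/funext => w; have [w0|w0|->] := ltgtP w 0.
- have [c /andP[_ c0]] := mean_value w0 (fun x _ => F' x).
  rewrite F0 (max_r (ltW c0)) mulr0 mul0r sub0r => /eqP.
  by rewrite oppr_eq0 => /eqP ->; rewrite expr0n.
- have D (x : R) : is_derive x 1 (fun x => F x - x * x)
      (2 * Num.max x 0 - (x * 1 + x * 1)).
    exact: is_derive_sub (F' x) (is_derive_mul (is_derive_id x 1) (is_derive_id x 1)).
  have [c /andP[c0 _]] := mean_value w0 (fun x _ => D x).
  rewrite F0 mulr0 subr0 subr0 (max_l (ltW c0)).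
  have -> : 2 * c - (c * 1 + c * 1) = 0 by ring.
  by rewrite mul0r expr2 => /subr0_eq ->.
- by rewrite F0 expr0n.
Qed.

(** For [e >= 0] this is [(|v| - e)_+ ^ 2], split into two one-sided squares, each of class C^1. *)
Definition cutoff e v : R := Num.max (v - e) 0 ^+ 2 + Num.max (- v - e) 0 ^+ 2.

Definition dcutoff e v : R := 2 * (Num.max (v - e) 0 - Num.max (- v - e) 0).

Lemma is_derive_cutoff e v : is_derive v 1 (cutoff e) (dcutoff e v).
Proof.
have l1 : is_derive v 1 (fun v => v - e) (1 - 0).
  exact: is_derive_sub (is_derive_id v 1) (is_derive_cst e v 1).
have l2 : is_derive v 1 (fun v => - v - e) (- 1 - 0).
  exact: is_derive_sub (is_deriveNid v 1) (is_derive_cst e v 1).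
have D : is_derive v 1 (cutoff e) _ := is_derive_add
  (@is_derive1_comp R _ (fun v => v - e) v _ _ (is_derive_pos_sqr (v - e)) l1)
  (@is_derive1_comp R _ (fun v => - v - e) v _ _ (is_derive_pos_sqr (- v - e)) l2).
apply: (is_derive_eq D).
by rewrite /dcutoff; ring.
Qed.

Lemma continuous_dcutoff e : continuous (dcutoff e).
Proof.
move=> v; apply: cvgM; first exact: cvg_cst.
apply: cvgB.
  apply: (@continuous_comp _ _ _ (fun v => v - e) (fun v : R => Num.max v 0));
    last exact: continuous_pos.
  by apply: cvgB; [exact: cvg_id|exact: cvg_cst].
apply: (@continuous_comp _ _ _ (fun v => - v - e) (fun v : R => Num.max v 0));
  last exact: continuous_pos.
by apply: cvgB; [apply: cvgN; exact: cvg_id|exact: cvg_cst].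
Qed.

Lemma cutoff0 e v : `|v| <= e -> cutoff e v = 0 /\ dcutoff e v = 0.
Proof.
rewrite ler_norml => /andP[v1 v2]; rewrite /cutoff /dcutoff !max_r; lra.
Qed.

(* This identity makes the cross term of the divergence a perfect square. *)
Lemma dcutoff_sqr e v : 0 <= e -> dcutoff e v ^+ 2 = 4 * cutoff e v.
Proof.
move=> e0; rewrite /cutoff /dcutoff.
have [h|h] := leP (v - e) 0; first by ring.
by rewrite (@max_r _ _ (- v - e)); [ring|lra].
Qed.

Lemma cutoff_close e v : 0 <= e -> `|v ^+ 2 - cutoff e v| <= 2 * e * `|v|.
Proof.
move=> e0; rewrite /cutoff ler_norml.
have [v0|v0] := leP 0 v.
  rewrite ger0_norm// (@max_r _ _ (- v - e)); last lra.
  by case: (leP (v - e) 0) => h; nra.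
rewrite ltr0_norm// (@max_r _ _ (v - e)); last lra.
by case: (leP (- v - e) 0) => h; nra.
Qed.

End cutoff.

(** * The divergence argument with the field [grad u / u] *)

Section positive_supersolution.
Context {R : realType} {n : nat}.
Variables (u xi a : 'rV[R]_n -> R) (L : R).
Hypotheses (uC2 : continuously_differentiable 2 u)
  (xiC1 : continuously_differentiable 1 xi) (xi_supp : compactly_supported xi).
Hypotheses (ca : continuous a) (aL : forall x, `|a x| <= L).
Hypothesis xi0 : forall x, u x = 0 -> xi x = 0.
Hypothesis super : forall x, u x != 0 -> laplacian u x / u x <= - a x.
Implicit Types (x y : 'rV[R]_n) (i : 'I_n).

Let du : forall x, differentiable u x := uC2.1.
Let d2u i : forall x, differentiable (partial i u) x := (uC2.2 i).1.
Let dxi : forall x, differentiable xi x := xiC1.1.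
Let cu : continuous u.
Proof. by move=> x; exact: differentiable_continuous. Qed.
Let cdu i : continuous (partial i u).
Proof. by move=> x; exact: differentiable_continuous. Qed.
Let cxi : continuous xi.
Proof. by move=> x; exact: differentiable_continuous. Qed.
Let cdxi i : continuous (partial i xi) := xiC1.2 i.
Let cd2u i : continuous (partial i (partial i u)) := (uC2.2 i).2 i.

Let coord_le_norm x i : `|x 0 i| <= `|x|.
Proof.
by rewrite [leRHS]/Num.norm/= mx_normrE; apply/bigmax_geP; right; exists (0, i).
Qed.

(** Vanishing on a neighbourhood, rather than at the point, makes the derivatives of [xi] vanish as
    well. *)
Lemma support_box : exists2 B, 0 <= B & forall x i, B < `|x 0 i| ->
  \forall y \near x, xi y = 0.
Proof.
have [B [_ hB]] := compact_bounded xi_supp.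
exists (Num.max 0 (B + 1)); first by rewrite le_max lexx.
move=> x i xi_gt.
have nx : ~ closure [set y | xi y != 0] x.
  move=> /(hB (Num.max 0 (B + 1))) h.
  have : `|x| <= Num.max 0 (B + 1) by apply: h; rewrite lt_max ltrDl ltr01 orbT.
  by rewrite leNgt => /negP; apply; apply: lt_le_trans xi_gt (coord_le_norm _ _).
have : nbhs x (~` closure [set y | xi y != 0]).
  by apply: open_nbhs_nbhs; split=> //; apply: closed_openC; exact: closed_closure.
apply: filterS => y ny; apply/eqP/negPn/negP => xiy; apply: ny.
exact: subset_closure.
Qed.

(** Near a zero of [q] the numerator vanishes identically, so the quotient is locally [0], also
    where division by zero returns [0]. *)
Lemma continuous_quotient (p q : 'rV[R]_n -> R) : continuous p -> continuous q ->
  (forall x, q x = 0 -> \forall y \near x, p y = 0) ->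
  continuous (fun x => p x / q x).
Proof.
move=> cp cq pq x; have [qx|qx] := eqVneq (q x) 0.
  have e : \forall y \near x, 0 = p y / q y.
    by apply: filterS (pq x qx) => y ->; rewrite mul0r.
  rewrite /continuous_at qx invr0 mulr0.
  by apply: cvg_trans (near_eq_cvg e) _; exact: cvg_cst.
exact: (cvgM (@cp x) (cvgV qx (@cq x))).
Qed.

Lemma sqr_enorm_gradient x :
  enorm (gradient xi x) ^+ 2 = \sum_i partial i xi x ^+ 2.
Proof.
rewrite sqr_sqrtr ?sumr_ge0// => [|i _]; last exact: sqr_ge0.
by apply: eq_bigr => i _; rewrite mxE.
Qed.

Lemma energy_density_in_box B :
  (forall x i, B < `|x 0 i| -> \forall y \near x, xi y = 0) ->
  continuous_in_box B (fun x => enorm (gradient xi x) ^+ 2 - a x * xi x ^+ 2).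
Proof.
move=> xiB; under eq_fun do rewrite sqr_enorm_gradient expr2.
split.
  have cs : continuous (fun x => \sum_i partial i xi x ^+ 2).
    apply: (continuous_big (@add_continuous R)) => i _ x.
    exact: (cvgM (@cdxi i x) (@cdxi i x)).
  by move=> x; exact: (cvgB (@cs x) (cvgM (@ca x) (cvgM (@cxi x) (@cxi x)))).
move=> x i /xiB xi_near; rewrite (nbhs_singleton xi_near) !mulr0 subr0.
rewrite big1// => j _; suff -> : partial j xi x = 0 by rewrite expr0n.
rewrite /partial (near_eq_derive _ (g := cst 0))// ?derive_cst//.
Qed.

Section approximation.
Variables (e : R).
Hypothesis e_gt0 : 0 < e.

(* Where [u x = 0] the division returns the correct value [0], since [cutoff]
   vanishes near such points. *)
Let flux i x := cutoff e (xi x) * partial i u x / u x.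

Let dflux i x :=
  (dcutoff e (xi x) * partial i xi x * partial i u x
   + cutoff e (xi x) * partial i (partial i u) x) / u x
  - cutoff e (xi x) * partial i u x ^+ 2 / (u x * u x).

(** By continuity [xi] stays below [e] in absolute value near a zero of [u]. This is why [xi ^+ 2]
    is replaced by the cutoff: the square need not vanish on a neighbourhood. *)
Let cutoff_near x : u x = 0 ->
  \forall y \near x, cutoff e (xi y) = 0 /\ dcutoff e (xi y) = 0.
Proof.
move=> ux; have : xi y @[y --> x] --> (0 : R) by rewrite -(xi0 ux); exact: cxi.
move=> /cvgrPdist_lt /(_ e e_gt0).
apply: filterS => y; rewrite sub0r normrN => /ltW; exact: cutoff0.
Qed.

Let continuous_cutoff_xi : continuous (fun x => cutoff e (xi x)).
Proof.
move=> x; apply: (@continuous_comp _ _ _ xi (cutoff e)); first exact: cxi.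
exact: is_derive_continuous (is_derive_cutoff e (xi x)).
Qed.

Let continuous_dflux i : continuous (dflux i).
Proof.
move=> x.
have cd : continuous (fun x => dcutoff e (xi x)).
  move=> y; apply: (@continuous_comp _ _ _ xi (dcutoff e)); first exact: cxi.
  exact: continuous_dcutoff.
have c1 : continuous (fun x => (dcutoff e (xi x) * partial i xi x * partial i u x
    + cutoff e (xi x) * partial i (partial i u) x) / u x).
  apply: continuous_quotient => [y||y uy]; last 2 first.
  - exact: cu.
  - by apply: filterS (cutoff_near uy) => z [-> ->]; rewrite !mul0r addr0.
  - exact: (cvgD (cvgM (cvgM (@cd y) (@cdxi i y)) (@cdu i y))
      (cvgM (@continuous_cutoff_xi y) (@cd2u i y))).
have c2 : continuous (fun x => cutoff e (xi x) * partial i u x ^+ 2 / (u x * u x)).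
  apply: continuous_quotient => [y|y|y /eqP].
  - exact: (cvgM (@continuous_cutoff_xi y) (cvgM (@cdu i y) (@cdu i y))).
  - exact: (cvgM (@cu y) (@cu y)).
  - rewrite mulf_eq0 orbb => /eqP uy.
    by apply: filterS (cutoff_near uy) => z [-> _]; rewrite !mul0r.
exact: (cvgB (@c1 x) (@c2 x)).
Qed.

Let is_derive_flux i x (t : R) :
  is_derive t 1 (fun t => flux i (line x i t)) (dflux i (line x i t)).
Proof.
set y := line x i t; have [uy|uy] := eqVneq (u y) 0.
  have z := cutoff_near uy; have [c0 d0] := nbhs_singleton z.
  rewrite /dflux c0 d0 !mul0r addr0 mul0r subrr.
  have : \forall s \near t, cutoff e (xi (line x i s)) = 0 /\ dcutoff e (xi (line x i s)) = 0.
    exact: (@continuous_line _ _ x i t _ z).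
  move=> zs; apply: near_eq_is_derive (is_derive_cst (0 : R) t 1).
  by apply: filterS zs => s [cs _]; rewrite /flux cs !mul0r.
have lu := is_derive_line (du y); have lxi := is_derive_line (dxi y).
have ldu := is_derive_line (d2u i y).
have lc := is_derive1_comp (is_derive_cutoff e (xi y)) lxi.
apply: (is_derive_eq (is_derive_mul (is_derive_mul lc ldu) (is_deriveV uy lu))).
rewrite /dflux -/y /GRing.scale/=; field; exact: uy.
Qed.

(** Write the cutoff as [q ^+ 2] and its derivative as [2 * q]. Off the zeros of [u],
    [|grad xi|^2 + q^2 * Delta u / u] exceeds the divergence by the square
    [|grad xi - q * grad u / u|^2], and [super] bounds [Delta u / u]. *)
Let sum_dflux_le x :
  \sum_i dflux i x <= enorm (gradient xi x) ^+ 2 - a x * cutoff e (xi x).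
Proof.
rewrite sqr_enorm_gradient; have [ux|ux] := eqVneq (u x) 0.
  have [c0 d0] := nbhs_singleton (cutoff_near ux).
  rewrite c0 mulr0 subr0; apply: ler_sum => i _.
  by rewrite /dflux c0 d0 !mul0r addr0 mul0r subrr sqr_ge0.
have c_ge0 : 0 <= cutoff e (xi x) by rewrite addr_ge0// sqr_ge0.
pose q := dcutoff e (xi x) / 2.
have dq : dcutoff e (xi x) = 2 * q by rewrite /q; field.
have cq : cutoff e (xi x) = q ^+ 2.
  by have := dcutoff_sqr (xi x) (ltW e_gt0); rewrite dq; lra.
apply: (@le_trans _ _ (\sum_i (partial i xi x ^+ 2 +
    cutoff e (xi x) / u x * partial i (partial i u) x))).
  apply: ler_sum => i _.
  rewrite -subr_ge0 /dflux dq cq.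
  rewrite (_ : _ - _ = (partial i xi x - q * (partial i u x / u x)) ^+ 2) ?sqr_ge0//.
  by field; exact: ux.
rewrite big_split/= -mulr_sumr lerD2l -/(laplacian u x).
by rewrite mulrAC -mulrA mulrC -mulNr ler_wpM2r// super.
Qed.

(** The divergence integrates to [0]; replacing the cutoff by [xi ^+ 2] costs at most
    [2 * e * L * |xi|] pointwise, by [cutoff_close]. *)
Lemma approximate_stability B : 0 <= B ->
  (forall x i, B < `|x 0 i| -> \forall y \near x, xi y = 0) ->
  (0 <= euclidean_integral (fun x => (enorm (gradient xi x) ^+ 2 - a x * xi x ^+ 2)%R) +
    (2 * e * L)%:E * euclidean_integral (fun x => `|xi x|%R))%E.
Proof.
move=> B0 xiB; have sI := energy_density_in_box xiB.
have sX : continuous_in_box B (fun x => `|xi x|).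
  split=> [x|x i /xiB/nbhs_singleton ->]; last by rewrite normr0.
  exact: (cvg_norm (@cxi x)).
have zero x i : B < `|x 0 i| -> cutoff e (xi x) = 0 /\ dcutoff e (xi x) = 0.
  by move=> /xiB/nbhs_singleton ->; apply: cutoff0; rewrite normr0 ltW.
have sF i : continuous_in_box B (dflux i).
  split=> [|x j /zero[c0 d0]]; first exact: continuous_dflux.
  by rewrite /dflux c0 d0 !mul0r addr0 mul0r subrr.
have F0 i : euclidean_integral (dflux i) = 0%E.
  apply: (euclidean_integral_partial0 B0 (is_derive_flux i) (sF i)).
  by move=> x j /zero[c0 _]; rewrite /flux c0 !mul0r.
have [sS S0] := euclidean_integral_sum0 B0 sF F0.
have sX2 := continuous_in_boxZ (2 * e * L) sX.
rewrite -(euclidean_integralZ (2 * e * L) B0 sX) -(euclidean_integralD B0 sI sX2) -S0.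
apply: le_integral => //.
- exact: integrable_in_box B0 sS.
- exact: (integrable_in_box B0 (continuous_in_boxD sI sX2)).
- move=> t _; rewrite lee_fin; set x := \row_i _.
  apply: le_trans (sum_dflux_le x) _.
  have h : a x * (xi x ^+ 2 - cutoff e (xi x)) <= L * (2 * e * `|xi x|).
    apply: le_trans (ler_norm _) _; rewrite normrM.
    by apply: ler_pM => //; exact: cutoff_close (ltW e_gt0).
  by rewrite /=; move: h; rewrite mulrBr; lra.
Qed.

End approximation.

Lemma stability :
  (0 <= euclidean_integral (fun x => (enorm (gradient xi x) ^+ 2 - a x * xi x ^+ 2)%R))%E.
Proof.
have [B B0 xiB] := support_box.
have sI := energy_density_in_box xiB.
have sX : continuous_in_box B (fun x => `|xi x|).
  split=> [x|x i /xiB/nbhs_singleton ->]; last by rewrite normr0.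
  exact: (cvg_norm (@cxi x)).
have app e e0 := @approximate_stability e e0 B B0 xiB.
have /fineK rE := euclidean_integral_fin B0 sI.
have /fineK sE := euclidean_integral_fin B0 sX.
rewrite -rE -sE in app *; move: (fine _) (fine _) app => s r app.
rewrite lee_fin leNgt; apply/negP => r0.
(* Here [r] is the energy and [s] the integral of [|xi|]. This [e] makes [2 * e * |L * s|] smaller
   than [- r], so the approximate inequality fails. *)
pose e := - r / (2 * (2 * `|L * s| + 1)).
have p0 : 0 < 2 * `|L * s| + 1 by rewrite ltr_wpDl// mulr_ge0.
have q0 : 0 < 2 * (2 * `|L * s| + 1) by rewrite mulr_gt0.
have e0 : 0 < e by apply: divr_gt0 => //; rewrite oppr_gt0.
have := app e e0; rewrite -EFinM -EFinD lee_fin.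
have e1 : e * (2 * (2 * `|L * s| + 1)) = - r by rewrite divfK// gt_eqF.
have : e * (L * s) <= e * `|L * s| by rewrite ler_pM2l// ler_norm.
nra.
Qed.

End positive_supersolution.

(** * The linearized inequality for [u] and the stability of [u] *)

(** As [f 0 = 0], for positive [v] the slope [f v / v] is the value of [f'] at some point of
    [(0, v)], at least [f'(v)] by monotonicity. Negative [v] follow since [f'] and the slope are
    even. *)
Lemma derive1_le_slope (R : realType) (M : R) (f : R -> R) (v : R) :
  C1_real f -> (forall v : R, f (- v) = - f v) ->
  (forall a b : R, 0 < a -> a <= b -> b < M -> derive1 f b <= derive1 f a) ->
  v != 0 -> `|v| < M -> derive1 f v <= f v / v.
Proof.
move=> fC1 f_odd f'_decr; have pos w : 0 < w -> w < M -> derive1 f w <= f w / w.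
  move=> w0 wM; have f' (z : R) : is_derive z 1 f (derive1 f z).
    by split; [exact: (fC1.1 z)|rewrite derive1E].
  have f0 : f 0 = 0 by have := f_odd 0; rewrite oppr0; lra.
  have [c /andP[c0 cw]] := mean_value w0 (fun z _ => f' z).
  rewrite f0 !subr0 => ->; rewrite mulfK ?gt_eqF//.
  exact: f'_decr (ltW cw) wM.
move=> v0; have [vneg|vpos|veq] := ltgtP v 0 => vM.
- rewrite -(derive1_even fC1 f_odd) (_ : f v / v = f (- v) / - v).
    by apply: pos; rewrite ?oppr_gt0//; move: vM; rewrite ltr0_norm.
  by rewrite f_odd invrN mulrNN.
- by apply: pos => //; move: vM; rewrite gtr0_norm.
- by rewrite veq eqxx in v0.
Qed.

Theorem proposition1p10 (R : realType) (m : nat) (M : R) (f : R -> R)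
  (m_ge1 : (1 <= m)%N)
  (M_gt0 : 0 < M)
  (f_C1 : C1_real f)
  (f_odd : forall v : R, f (- v) = - f v)
  (G_ge0 : forall v : R, 0 <= potential f M v)
  (G_M : potential f M M = 0)
  (G_NM : potential f M (- M) = 0)
  (G_gt0 : forall v : R, - M < v < M -> 0 < potential f M v)
  (f'_decr : forall a b : R, 0 < a -> a <= b -> b < M ->
    derive1 f b <= derive1 f a)
  (u : 'rV[R]_(m + m) -> R)
  (u_sol : classical_solution f u)
  (u_bounded : bounded_fun u)
  (u_cone : forall x, simons_cone x -> u x = 0)
  (u_sign : same_sign_s_minus_t u) :
  stable_vanishing_on_cone f u.
Proof.
move=> xi xiC1 xi_supp xi_cone; rewrite /quadratic_form.
have uM := solution_bound m_ge1 M_gt0 f_C1 f_odd G_ge0 u_sol u_bounded u_cone u_sign.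
(* Since [|u| < M], the maximum of [|f'|] on [[-M, M]] bounds the coefficient [f'(u)] everywhere. *)
have [v0 _ f'_max] : exists2 v0, v0 \in `[- M, M]%R &
    forall v, v \in `[- M, M]%R -> `|derive1 f v| <= `|derive1 f v0|.
  apply: (@EVT_max R (fun v => `|derive1 f v|)); first by lra.
  by apply: continuous_subspaceT => v; exact: (cvg_norm (f_C1.2 v)).
apply: (stability (u := u) (L := `|derive1 f v0|) u_sol.1 xiC1 xi_supp).
- move=> x; apply: (@continuous_comp _ _ _ u (derive1 f)); last exact: f_C1.2.
  exact: differentiable_continuous (u_sol.1.1 x).
- by move=> x; apply: f'_max; rewrite in_itv/= -ler_norml ltW.
(* The sign condition places every zero of [u] on the cone, where [xi] vanishes. *)
- move=> x ux; apply: xi_cone; apply/eqP; apply: contraT; rewrite neq_lt.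
  by move=> /orP[/u_sign.2|/u_sign.1]; rewrite ux ltxx.
(* By the equation, [Delta u / u] is [- f(u) / u], so the slope inequality applies at the value
   [u x]. *)
- move=> x ux; rewrite -[laplacian u x]opprK u_sol.2 mulNr lerN2.
  exact: derive1_le_slope f_C1 f_odd f'_decr ux (uM x).
Qed.
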